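(* Let $(X,d,\mathfrak m)$ be a metric measure space and let $\Omega\subset X$ be a bounded open set. Then for every $\varepsilon>0$ there exists a closed set $G\subset X$ with $G\subset\Omega$ such that $\mathfrak m(\Omega\setminus G)<\varepsilon$ and such that the zero extension gives a bounded operator from $BV(G)$ to $BV(X)$; that is, there is a constant $C>0$ such that for every $f\in BV(G)$ the function $\tilde f\colon X\to\mathbb R$ equal to $f$ on $G$ and to $0$ on $X\setminus G$ belongs to $BV(X)$ and satisfies $\|\tilde f\|_{BV(X)}\le C\|f\|_{BV(G)}$.
   Context: Metric measure space: a triple $(X,d,\mathfrak m)$ with $(X,d)$ a complete separable metric space and $\mathfrak m$ a Borel measure on $X$ that is finite on bounded sets. For a function $f$ that is Lipschitz near $x$, its asymptotic Lipschitz constant is $\mathrm{lip}_a(f)(x)=\inf_{r>0}\mathrm{Lip}(f|_{B_r(x)})$, where $\mathrm{Lip}$ denotes the (global) Lipschitz constant and $B_r(x)$ is the open ball. For $A$ open, $\mathrm{LIP}_{\rm loc}(A)$ is the set of functions $f$ such that every $x\in A$ has a ball $B_r(x)\subset A$ on which $f$ is Lipschitz. $L^1_{\rm loc}$ and convergence in $L^1_{\rm loc}$ are understood in the usual sense (every point has a neighbourhood on which the function is integrable, resp. on which convergence in $L^1$ holds). Total variation: for $f\in L^1_{\rm loc}(\mathfrak m)$ and $A\subset X$ open, $$|Df|_X(A)=\inf\Big\{\liminf_{n\to\infty}\int_A \mathrm{lip}_a(f_n)\,d\mathfrak m:\ f_n\in \mathrm{LIP}_{\rm loc}(A),\ f_n\to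 f\text{ in }L^1_{\rm loc}(\mathfrak m|_A)\Big\},$$ and for Borel $F\subset X$, $|Df|_X(F)=\inf\{|Df|_X(A): F\subset A,\ A\text{ open}\}$. For a Borel set $B\subset X$ and $f\in L^1_{\rm loc}(\mathfrak m|_B)$, $|Df|_B$ denotes the total variation measure of $f$ computed in the metric measure space $(X,d,\mathfrak m|_B)$. Then $BV(B)=\{f\in L^1(\mathfrak m|_B): |Df|_B(B)<\infty\}$ with norm $\|f\|_{BV(B)}=\|f\|_{L^1(\mathfrak m|_B)}+|Df|_B(B)$. *)

(* Defs.v *)
From HB Require Import structures.
From mathcomp Require Import all_boot all_order all_algebra.
From mathcomp Require Import all_classical all_reals all_analysis.

Set Implicit Arguments.
Unset Strict Implicit.
Unset Printing Implicit Defensive.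

Import Order.TTheory GRing.Theory Num.Theory.
Import numFieldNormedType.Exports.

Local Open Scope classical_set_scope.
Local Open Scope ring_scope.

(* The structure does not relate the sigma-algebra to the topology: see
   [borel_space]. *)
#[short(type="completeMetricMeasurableType")]
HB.structure Definition CompleteMetricMeasurable
    (d : measure_display) (R : realType) :=
  {T of Complete T & Metric R T & Measurable d T}.

Section metric_measure_space.
Context {d : measure_display} {R : realType}.
Variable X : completeMetricMeasurableType d R.

Definition borel_space : Prop :=
  (measurable : set (set X)) = <<s (open : set (set X)) >>.

Definition separable_space : Prop :=
  exists2 D : set X, countable D & dense D.

Definition metric_bounded (A : set X) : Prop :=
  exists M : R, forall x y, A x -> A y -> mdist x y <= M.

Definition metric_measure_space (m : {measure set X -> \bar R}) : Prop :=
  [/\ borel_space, separable_space &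
      forall B, measurable B -> metric_bounded B -> (m B < +oo)%E].

End metric_measure_space.

Section lipschitz_constants.
Context {d : measure_display} {R : realType}
  {X : completeMetricMeasurableType d R}.
Implicit Types (f : X -> R) (S A : set X).

Definition lipschitz_const (k : R) f S : Prop :=
  0 <= k /\ forall x y, S x -> S y -> `|f x - f y| <= k * mdist x y.

(* Lip(f|_S), equal to +oo when f is not Lipschitz on S. *)
Definition Lip f S : \bar R :=
  ereal_inf [set k%:E | k in [set k | lipschitz_const k f S]].

(* Only the values of f near x matter, since Lip f is monotone in the ball. *)
Definition lip_a f (x : X) : \bar R :=
  ereal_inf [set Lip f (ball x r) | r in [set r : R | 0 < r]].

(* A function on A is represented by an arbitrary extension to X. *)
Definition LIP_loc A : set (X -> R) :=
  [set f | forall x, A x -> exists r : R,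
     [/\ 0 < r, ball x r `<=` A & exists k, lipschitz_const k f (ball x r)]].

End lipschitz_constants.

Section bounded_variation.
Context {d : measure_display} {R : realType}
  {X : completeMetricMeasurableType d R}.
Implicit Types (f : X -> R) (A B F : set X).
Local Open Scope ereal_scope.

(* f_n --> f in L^1_loc(mu|_A), tested at the points of A. *)
Definition cvg_L1loc (mu : {measure set X -> \bar R}) A
    (f_ : (X -> R)^nat) f : Prop :=
  forall x, A x -> exists2 U : set X, open_nbhs x U &
    (fun n => \int[mu]_(y in U `&` A) `|f_ n y - f y|%:E) @ \oo --> 0.

Definition total_variation_open (mu : {measure set X -> \bar R}) f A
    : \bar R :=
  ereal_inf [set limn_einf (fun n => \int[mu]_(x in A) lip_a (f_ n) x) |
    f_ in [set f_ : (X -> R)^nat |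
             (forall n, LIP_loc A (f_ n)) /\ cvg_L1loc mu A f_ f]].

Definition total_variation (mu : {measure set X -> \bar R}) f F : \bar R :=
  ereal_inf [set total_variation_open mu f A |
    A in [set A | open A /\ F `<=` A]].

(* An element of L^1(m|_B) is represented by a measurable function on the whole
   of X: its values outside B are irrelevant, since ~` B is m|_B-null. *)
Definition BV (m : {measure set X -> \bar R}) B (mB : measurable B)
    : set (X -> R) :=
  [set f | (mrestr m mB).-integrable setT (EFin \o f) /\
           total_variation (mrestr m mB) f B < +oo].

Definition BV_norm (m : {measure set X -> \bar R}) B (mB : measurable B) f
    : \bar R :=
  \int[mrestr m mB]_x `|f x|%:E + total_variation (mrestr m mB) f B.

Definition zero_extension B f : X -> R := patch (fun=> 0%R) B f.

End bounded_variation.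

(* Main.v *)
From HB Require Import structures.
Require Import Defs.
From mathcomp Require Import all_boot all_order all_algebra.
From mathcomp Require Import all_classical all_reals all_analysis.
From mathcomp Require Import measurable_realfun lra.

(* Call c an upper bound for the energy of u when u is an L^1-limit of locally
   Lipschitz functions h with liminf of the integrals of lip_a h at most c.

   Inside Omega there is a compact K0 of finite energy, i.e. 1_K0 has finite
   energy, that almost exhausts Omega: it is a superlevel set of the limit of
   decreasing cutoffs of uniformly bounded energy, each moving the support
   closer to a finite net.  An Ekeland-type descent through compact subsets of K0
   produces a compact K, still almost exhausting Omega, with
     P(K) <= P(K') + lam m(K \ K')   for all compact K' in K,
   where P is the energy of the indicator; lower semicontinuity along decreasing
   sequences is enough, no compactness in BV is needed.

   Let now f be locally Lipschitz with |f| <= M, and g close to 1_K with nearly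
   optimal energy.  The product rule gives
     lip(f g) + lip((M - |f|) g) <= M lip g + 2 g lip f.
   The function (M - |f|) 1_K has compact superlevel sets in K, so by coarea and
   minimality its energy is at least M P(K) - lam int_K |f|.  Since g has energy
   about P(K), the terms M P(K) cancel, and the energy of f 1_K is at most
   2 int_K lip f + lam int_K |f|, a bound free of M.  As K is compact, functions
   that are locally Lipschitz near K can be cut off, and convergence in L^1_loc
   on K is convergence in L^1(K), so the bound passes to all of BV(K). *)

Set Implicit Arguments.
Unset Strict Implicit.
Unset Printing Implicit Defensive.

Import Order.TTheory GRing.Theory Num.Theory.
Import numFieldNormedType.Exports.

Local Open Scope classical_set_scope.
Local Open Scope ring_scope.

(** * Asymptotic Lipschitz constants *)

Section asymptotic_lipschitz.
Context {d : measure_display} {R : realType} {X : completeMetricMeasurableType d R}.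
Implicit Types (f g : X -> R) (x y : X) (k r : R).

Lemma lip_a_lbound f x k r : 0 < r -> lipschitz_const k f (ball x r) ->
  (lip_a f x <= k%:E)%E.
Proof.
move=> r0 kf; apply: ge_ereal_inf; exists (Lip f (ball x r)); first by exists r.
by apply: ge_ereal_inf; exists k%:E => //; exists k.
Qed.

Lemma le_lip_a f x (c : \bar R) :
  (forall k r, 0 < r -> lipschitz_const k f (ball x r) -> (c <= k%:E)%E) ->
  (c <= lip_a f x)%E.
Proof.
move=> H; apply: le_ereal_inf_tmp => _ [r /= r0 <-].
by apply: le_ereal_inf_tmp => _ [k /= kf <-]; exact: H kf.
Qed.

Lemma lip_a_ltP f x (c : \bar R) : (lip_a f x < c)%E ->
  exists k r, [/\ 0 < r, lipschitz_const k f (ball x r) & (k%:E < c)%E].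
Proof.
by move=> /ereal_inf_lt[_ [r /= r0 <-]] /ereal_inf_lt[_ [k /= kf <-] kc]; exists k, r.
Qed.

Lemma lip_a_ge0 f x : (0 <= lip_a f x)%E.
Proof. by apply: le_lip_a => k r _ [k0 _]; rewrite lee_fin. Qed.

Lemma lipschitz_const_sub k f (A B : set X) : A `<=` B ->
  lipschitz_const k f B -> lipschitz_const k f A.
Proof. by move=> AB [k0 H]; split=> // x y Ax Ay; apply: H; exact: AB. Qed.

Lemma ball_sub x r s : r <= s -> ball x r `<=` ball x s.
Proof. by move=> rs y; rewrite !ballEmdist /= => /lt_le_trans; apply. Qed.

Lemma ball_min1 x r s : ball x (Num.min r s) `<=` ball x r.
Proof. by apply: ball_sub; rewrite ge_min lexx. Qed.

Lemma ball_min2 x r s : ball x (Num.min r s) `<=` ball x s.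
Proof. by apply: ball_sub; rewrite ge_min lexx orbT. Qed.

Lemma ball_in x y r : ball x r y -> exists2 s, 0 < s & ball y s `<=` ball x r.
Proof.
rewrite !ballEmdist /= => xy; exists (r - mdist x y); first by rewrite subr_gt0.
move=> z; rewrite !ballEmdist /= => yz.
by have := metric_triangle x y z; lra.
Qed.

Lemma openP_ball (A : set X) :
  (forall x, A x -> exists2 r, 0 < r & ball x r `<=` A) -> open A.
Proof.
move=> H; rewrite openE => x /H[r r0 rA].
by apply/nbhs_ballP; exists r.
Qed.

Lemma open_ballP (A : set X) x : open A -> A x ->
  exists2 r, 0 < r & ball x r `<=` A.
Proof.
move=> oA Ax; have : nbhs x A by exact: open_nbhs_nbhs.
by move=> /nbhs_ballP[r /= r0 rA]; exists r.
Qed.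

(** A Lipschitz constant valid on a ball also bounds [lip_a f] at every other point of that ball. So
    [lip_a f] is upper semicontinuous for any [f], and hence Borel. *)
Lemma open_lip_a_lt f c : open [set x | (lip_a f x < c)%E].
Proof.
apply: openP_ball => x /= /lip_a_ltP[k [r [r0 kf kc]]].
exists r => // y /ball_in[s s0 sr] /=.
apply: le_lt_trans kc; apply: (lip_a_lbound s0).
exact: lipschitz_const_sub kf.
Qed.

Lemma open_measurable_borel (hB : borel_space X) (A : set X) : open A -> measurable A.
Proof. by move=> oA; rewrite hB; exact: sub_gen_smallest. Qed.

Lemma closed_measurable_borel (hB : borel_space X) (A : set X) : closed A -> measurable A.
Proof.
move=> cA; rewrite -(setCK A); apply: measurableC.
by apply: open_measurable_borel => //; exact: closed_openC.
Qed.

Lemma measurable_lip_a (hB : borel_space X) f D : measurable D ->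
  measurable_fun D (lip_a f : X -> \bar R).
Proof.
move=> mD; apply: (measurability _ (ErealGenCInfty.measurableE R)).
move=> _ [_ [c ->] <-]; apply: measurableI => //.
rewrite (_ : _ @^-1` _ = ~` [set x | (lip_a f x < c%:E)%E]).
  by apply: measurableC; apply: open_measurable_borel => //; exact: open_lip_a_lt.
by apply/seteqP; split=> x /=; rewrite in_itv /= andbT; [rewrite leNgt => /negP|move=> /negP; rewrite -leNgt].
Qed.

Lemma lip_a_near f g x r : 0 < r -> (forall y, ball x r y -> f y = g y) ->
  (lip_a f x <= lip_a g x)%E.
Proof.
move=> r0 fg; apply: le_lip_a => k s s0 [k0 kg].
apply: (@lip_a_lbound _ _ _ (Num.min r s)); first by rewrite lt_min r0.
split=> // y z By Bz.
rewrite (fg _ (ball_min1 By)) (fg _ (ball_min1 Bz)).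
exact: kg (ball_min2 By) (ball_min2 Bz).
Qed.

Lemma lip_a_cst0 f x r a : 0 < r -> (forall y, ball x r y -> f y = a) -> lip_a f x = 0%E.
Proof.
move=> r0 fa; apply/eqP; rewrite eq_le lip_a_ge0 andbT.
apply: (lip_a_lbound r0); split=> // y z By Bz; rewrite !fa // subrr normr0 mul0r.
by [].
Qed.

Lemma lip_a_comp f x (phi : R -> R) k : 0 < k ->
  (forall a b, `|phi a - phi b| <= k * `|a - b|) ->
  (lip_a (phi \o f) x <= k%:E * lip_a f x)%E.
Proof.
move=> k0 kphi; rewrite -lee_pdivrMl//; apply: le_lip_a => l r r0 [l0 lf].
rewrite lee_pdivrMl// -EFinM; apply: (lip_a_lbound r0).
split=> [|y z By Bz]; first by rewrite mulr_ge0// ltW.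
apply: le_trans (kphi _ _) _; rewrite -mulrA ler_pM2l//; exact: lf.
Qed.

Lemma lip_a_comp1 f x (phi : R -> R) :
  (forall a b, `|phi a - phi b| <= `|a - b|) -> (lip_a (phi \o f) x <= lip_a f x)%E.
Proof.
move=> H; rewrite -[leRHS]mul1e; apply: lip_a_comp => // a b; by rewrite mul1r.
Qed.

Lemma lip_a_fineK f x : (lip_a f x < +oo)%E -> (lip_a f x)%E = (fine (lip_a f x))%:E.
Proof. by move=> ?; rewrite fineK// ge0_fin_numE ?lip_a_ge0. Qed.

(** The restriction [e <= 1] allows quadratic errors to be absorbed into linear ones, as in the
    product rule below. *)
Lemma ler_of_linear_slack (a b c : R) : (forall e, 0 < e -> e <= 1 -> a <= b + c * e) -> a <= b.
Proof.
move=> H; rewrite leNgt; apply/negP => ba.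
pose C := `|c| + 1; have C0 : 0 < C by rewrite /C ltr_wpDl.
have cC : c <= C by have := ler_norm c; rewrite /C; lra.
pose e := Num.min 1 ((a - b) / (2 * C)).
have e0 : 0 < e by rewrite /e lt_min ltr01 divr_gt0 ?subr_gt0 ?mulr_gt0.
have e1 : e <= 1 by rewrite /e ge_min lexx.
have := H e e0 e1.
have : c * e <= C * e by rewrite (ler_wpM2r (ltW e0)).
have : C * e <= C * ((a - b) / (2 * C)) by rewrite (ler_wpM2l (ltW C0))// /e ge_min lexx orbT.
have -> : C * ((a - b) / (2 * C)) = (a - b) / 2.
  by rewrite mulrC invfM -!mulrA mulVf ?gt_eqF// mulr1.
by lra.
Qed.

Lemma lip_a_min f g x : (lip_a (fun y => Num.min (f y) (g y)) x <= lip_a f x + lip_a g x)%E.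
Proof.
have [/lip_a_fineK fE|] := ltP (lip_a f x) +oo%E; last first.
  by rewrite leye_eq => /eqP ->; rewrite addye ?leey// gt_eqF// (lt_le_trans _ (lip_a_ge0 _ _)).
have [/lip_a_fineK gE|] := ltP (lip_a g x) +oo%E; last first.
  by rewrite leye_eq => /eqP ->; rewrite addey ?leey// gt_eqF// (lt_le_trans _ (lip_a_ge0 _ _)).
rewrite fE gE; apply/lee_addgt0Pr => e e0.
have [k [r [r0 [k0 kf] ke]]] :
    exists k r, [/\ 0 < r, lipschitz_const k f (ball x r) &
      (k%:E < (fine (lip_a f x) + e / 2)%:E)%E].
  by apply: lip_a_ltP; rewrite {1}fE lte_fin; lra.
have [l [s [s0 [l0 lg] le]]] :
    exists k r, [/\ 0 < r, lipschitz_const k g (ball x r) &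
      (k%:E < (fine (lip_a g x) + e / 2)%:E)%E].
  by apply: lip_a_ltP; rewrite {1}gE lte_fin; lra.
apply: (@le_trans _ _ (k + l)%:E); last first.
  by move: ke le; rewrite !lte_fin -!EFinD lee_fin; lra.
apply: (@lip_a_lbound _ _ _ (Num.min r s)); first by rewrite lt_min r0.
split=> [|y z By Bz]; first by rewrite addr_ge0.
have {kf} := kf _ _ (ball_min1 By) (ball_min1 Bz).
have {lg} := lg _ _ (ball_min2 By) (ball_min2 Bz).
have := mdist_ge0 y z.
rewrite mulrDl; move: (mdist y z) => t t0.
have := mulr_ge0 k0 t0; have := mulr_ge0 l0 t0.
move: (k * t) (l * t) (f y) (f z) (g y) (g z) => a b c c' e1 e1'.
rewrite !ler_norml => ? ? /andP[? ?] /andP[? ?].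
by case: (leP c e1); case: (leP c' e1') => ? ?; apply/andP; split; lra.
Qed.

(** On a small ball [|f|] and [|g|] exceed their values at [x] by at most [e], and the increment of
    the product splits in the usual way. Finiteness is assumed because the convention [0 * +oo = 0]
    would otherwise drop a term where a factor vanishes. *)
Lemma lip_a_mul f g x : (lip_a f x < +oo)%E -> (lip_a g x < +oo)%E ->
  (lip_a (fun y => f y * g y)%R x <= `|f x|%:E * lip_a g x + `|g x|%:E * lip_a f x)%E.
Proof.
move=> ff gf; rewrite (lip_a_fineK ff) (lip_a_fineK gf) -!EFinM -EFinD.
set a := fine (lip_a f x); set b := fine (lip_a g x).
have fE : lip_a f x = a%:E by exact: lip_a_fineK.
have gE : lip_a g x = b%:E by exact: lip_a_fineK.
have a0 : 0 <= a by rewrite -lee_fin -fE lip_a_ge0.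
have b0 : 0 <= b by rewrite -lee_fin -gE lip_a_ge0.
suff H e : 0 < e -> e <= 1 -> (lip_a (fun y => f y * g y)%R x <=
    ((`|f x| + e) * (b + e) + (`|g x| + e) * (a + e))%:E)%E.
  have pf : (lip_a (fun y => f y * g y)%R x < +oo)%E by apply: le_lt_trans (H 1 ltr01 (lexx _)) (ltry _).
  rewrite (lip_a_fineK pf) lee_fin.
  apply: (@ler_of_linear_slack _ _ (`|f x| + `|g x| + a + b + 2)) => e e0 e1.
  have := H e e0 e1; rewrite (lip_a_fineK pf) lee_fin => /le_trans; apply.
  have ee : e * e <= e by rewrite ger_pMl.
  rewrite !mulrDl !mulrDr; lra.
move=> e0 e1.
have [k [r [r0 kf]]] : exists k r, [/\ 0 < r, lipschitz_const k f (ball x r) & (k%:E < (a + e)%:E)%E].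
  by apply: lip_a_ltP; rewrite {1}fE lte_fin; lra.
have [l [s [s0 lg]]] : exists k r, [/\ 0 < r, lipschitz_const k g (ball x r) & (k%:E < (b + e)%:E)%E].
  by apply: lip_a_ltP; rewrite {1}gE lte_fin; lra.
rewrite !lte_fin => le ke.
have [k0 {}kf] := kf; have [l0 {}lg] := lg.
(* Within this radius both Lipschitz bounds hold and both functions vary by at most [e]; adding 1 to
   [k] and [l] avoids division by zero. *)
pose t := Num.min (Num.min r s) (Num.min (e / (k + 1)) (e / (l + 1))).
have kp : 0 < k + 1 by lra.
have lp : 0 < l + 1 by lra.
have t0 : 0 < t by rewrite /t !lt_min r0 s0 !divr_gt0.
apply: (@le_trans _ _ ((`|f x| + e) * l + (`|g x| + e) * k)%:E); last first.
  rewrite lee_fin lerD// ler_wpM2l ?(ltW le) ?(ltW ke)// addr_ge0// ltW//.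
have xx : ball x t x by rewrite ballEmdist /= mdistxx.
have tk y : ball x t y -> `|f y| <= `|f x| + e.
  move=> By; have := kf _ _ (ball_min1 (ball_min1 By)) (ball_min1 (ball_min1 xx)).
  have : mdist y x < e / (k + 1).
    rewrite metric_sym; have := ball_min1 (ball_min2 By).
    by rewrite ballEmdist.
  have := mdist_ge0 y x; move: (mdist y x) => u u0 /ltW.
  rewrite ler_pdivlMr// mulrDr mulr1 mulrC => ue H.
  have := ler_normD (f y - f x) (f x); rewrite subrK; lra.
have tl y : ball x t y -> `|g y| <= `|g x| + e.
  move=> By; have := lg _ _ (ball_min2 (ball_min1 By)) (ball_min2 (ball_min1 xx)).
  have : mdist y x < e / (l + 1).
    rewrite metric_sym; have := ball_min2 (ball_min2 By).
    by rewrite ballEmdist.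
  have := mdist_ge0 y x; move: (mdist y x) => u u0 /ltW.
  rewrite ler_pdivlMr// mulrDr mulr1 mulrC => ue H.
  have := ler_normD (g y - g x) (g x); rewrite subrK; lra.
apply: (lip_a_lbound t0); split=> [|y z By Bz].
  by rewrite addr_ge0// mulr_ge0// addr_ge0// ltW.
have -> : f y * g y - f z * g z = f y * (g y - g z) + g z * (f y - f z).
  by rewrite mulrBr mulrBr (mulrC (g z) (f y)) (mulrC (g z) (f z)); lra.
apply: le_trans (ler_normD _ _) _; rewrite !normrM mulrDl -!mulrA.
apply: lerD; apply: ler_pM => //.
- exact: tk.
- exact: lg _ _ (ball_min2 (ball_min1 By)) (ball_min2 (ball_min1 Bz)).
- exact: tl.
- exact: kf _ _ (ball_min1 (ball_min1 By)) (ball_min1 (ball_min1 Bz)).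
Qed.

Lemma LIP_loc_lty (A : set X) f x : LIP_loc A f -> A x -> (lip_a f x < +oo)%E.
Proof.
move=> fA /fA[r [r0 _ [k kf]]]; apply: le_lt_trans (lip_a_lbound r0 kf) (ltry _).
Qed.

(** With [LIP_loc_lty] this reduces local Lipschitz continuity on an open set to finiteness of
    [lip_a], so stability under min, products and composition follows from the pointwise bounds. *)
Lemma LIP_locP (A : set X) f : open A ->
  (forall x, A x -> (lip_a f x < +oo)%E) -> LIP_loc A f.
Proof.
move=> oA H x Ax; have [k [r [r0 kf _]]] := lip_a_ltP (H x Ax).
have [s s0 sA] := open_ballP oA Ax.
exists (Num.min r s); split; first by rewrite lt_min r0.
  exact: subset_trans (@ball_min2 _ _ _) sA.
exists k; apply: lipschitz_const_sub kf; exact: ball_min1.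
Qed.

Lemma LIP_loc_open_lt (A : set X) f c : open A -> LIP_loc A f ->
  open (A `&` [set x | f x < c]).
Proof.
move=> oA fA; apply: openP_ball => x [Ax /= fc].
have [r [r0 rA [k [k0 kf]]]] := fA x Ax.
pose t := Num.min r ((c - f x) / (k + 1)).
have kp : 0 < k + 1 by lra.
have t0 : 0 < t by rewrite /t lt_min r0 divr_gt0// subr_gt0.
exists t => // y By; split; first exact: rA (ball_min1 By).
have xx : ball x r x by rewrite ballEmdist /= mdistxx.
have := kf _ _ (ball_min1 By) xx.
have : mdist y x < (c - f x) / (k + 1).
  by rewrite metric_sym; have := ball_min2 By; rewrite ballEmdist.
have := mdist_ge0 y x; move: (mdist y x) => u u0.
rewrite ltr_pdivlMr// mulrDr mulr1 mulrC => ue /=.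
have := ler_norm (f y - f x); lra.
Qed.

Lemma measurable_LIP_loc (hB : borel_space X) (A : set X) f : open A -> LIP_loc A f ->
  measurable_fun A (f : X -> R).
Proof.
move=> oA fA; have mA : measurable A by exact: open_measurable_borel.
apply: (measurability _ (RGenCInfty.measurableE R)) => //.
move=> _ [_ [c ->] <-].
rewrite (_ : _ `&` _ = A `\` (A `&` [set x | f x < c])).
  apply: measurableD => //; apply: open_measurable_borel => //; exact: LIP_loc_open_lt.
apply/seteqP; split=> x /=; rewrite in_itv /= andbT.
  by rewrite leNgt => -[Ax /negP H]; split=> // -[].
by move=> [Ax H]; split=> //; rewrite leNgt; apply/negP => ?; exact: H.
Qed.

End asymptotic_lipschitz.

(** * Inferior limits of extended real sequences *)

Section limits_inferior.
Context {R : realType}.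
Implicit Types (u : (\bar R)^nat) (a : \bar R) (c e : R).
Local Open Scope ereal_scope.

Lemma limn_einf_ge u a N : (forall n, (N <= n)%N -> a <= u n) -> a <= limn_einf u.
Proof.
move=> H; rewrite limn_einf_lim; apply: lime_ge; first exact: is_cvg_einfs.
exists N => // k /= Nk; apply: le_ereal_inf_tmp => _ [n /= kn <-].
by apply: H; exact: leq_trans kn.
Qed.

Lemma limn_einf_le u c :
  (forall e N, (0 < e)%R -> exists2 n, (N <= n)%N & u n <= (c + e)%:E) ->
  limn_einf u <= c%:E.
Proof.
move=> H; apply/lee_addgt0Pr => e e0; rewrite limn_einf_lim.
apply: lime_le; first exact: is_cvg_einfs.
apply: nearW => k; have [n kn une] := H e k e0.
by apply: ge_ereal_inf; exists (u n); [exists n|rewrite -EFinD].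
Qed.

Lemma limn_einf_frequently u c e N : limn_einf u <= c%:E -> (0 < e)%R ->
  exists2 n, (N <= n)%N & u n <= (c + e)%:E.
Proof.
move=> uc e0; apply: contrapT => H.
suff : (c + e)%:E <= limn_einf u.
  by move=> /le_trans/(_ uc); rewrite lee_fin; lra.
apply: (@limn_einf_ge _ _ N) => n Nn; rewrite leNgt; apply/negP => une.
by apply: H; exists n => //; exact: ltW.
Qed.

End limits_inferior.

(** * Relaxed energy *)

Section relaxed_variation.
Context {d : measure_display} {R : realType} {X : completeMetricMeasurableType d R}.
Variable m : {measure set X -> \bar R}.
Implicit Types (f g h u : X -> R) (c e : R).
Local Open Scope ereal_scope.

Definition L1dist f g : \bar R := \int[m]_x `|f x - g x|%:E.

(* Upper bounds of the relaxed energy are used instead of its value: the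
   admissible c form a closed set, so no infimum has to be taken. *)
Definition variation_le u c : Prop := forall e, (0 < e)%R ->
  exists h, [/\ LIP_loc setT h, L1dist h u <= e%:E &
    \int[m]_x lip_a h x <= (c + e)%:E].

Lemma measurable_abs_sub f g (D : set X) : measurable_fun D f -> measurable_fun D g ->
  measurable_fun D (fun x => `|f x - g x|%:E).
Proof.
move=> mf mg; apply/measurable_EFinP; apply: measurableT_comp => //.
exact: measurable_funB.
Qed.

Lemma L1dist_triangle f g h : measurable_fun setT f -> measurable_fun setT g ->
  measurable_fun setT h -> L1dist f h <= L1dist f g + L1dist g h.
Proof.
move=> mf mg mh; rewrite /L1dist -ge0_integralD//; do ?exact: measurable_abs_sub.
apply: ge0_le_integral => //; first exact: measurable_abs_sub.
  by apply: emeasurable_funD; exact: measurable_abs_sub.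
by move=> x _; rewrite -EFinD lee_fin; exact: ler_distD.
Qed.

(** Approximants with error [1/(n+1)] converge in L^1, hence in L^1_loc with the whole space as
    neighbourhood of every point. They therefore compete in the infimum that defines the total
    variation. *)
Lemma variation_le_total_variation u c : variation_le u c ->
  Defs.total_variation m u setT <= c%:E.
Proof.
move=> uc; have P n := uc n.+1%:R^-1%R ltac:(by rewrite invr_gt0).
have [h Hh] := choice P.
apply: ge_ereal_inf; exists (total_variation_open m u setT).
  by exists setT => //; split=> //; exact: openT.
apply: ge_ereal_inf; exists (limn_einf (fun n => \int[m]_x lip_a (h n) x)).
  exists h => //; split; first by move=> n; have [] := Hh n.
  move=> x _; exists setT; first by split=> //; exact: openT.
  rewrite setTI; apply/fine_cvgP; split.
    apply: nearW => n; rewrite ge0_fin_numE ?integral_ge0//.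
    by have [_ H _] := Hh n; exact: le_lt_trans H (ltry _).
  apply/cvgrPdist_le => /= e e0; near=> n.
  rewrite sub0r normrN ger0_norm; last by apply: fine_ge0; exact: integral_ge0.
  rewrite -lee_fin fineK; last first.
    rewrite ge0_fin_numE ?integral_ge0//.
    by have [_ H _] := Hh n; exact: le_lt_trans H (ltry _).
  have [_ H _] := Hh n; apply: le_trans H _; rewrite lee_fin ltW//.
  by near: n; exact: near_infty_natSinv_lt (PosNum e0).
apply: limn_einf_le => e N e0.
have [M _ HM] := near_infty_natSinv_lt (PosNum e0).
exists (maxn N M); first exact: leq_maxl.
have [_ _ H] := Hh (maxn N M); apply: le_trans H _.
by rewrite lee_fin lerD2l ltW//; apply: HM; rewrite /= leq_maxr.
Unshelve. all: by end_near. Qed.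

Lemma variation_le_ge0 u c : variation_le u c -> (0 <= c)%R.
Proof.
move=> uc; rewrite leNgt; apply/negP => c0.
have [|h [_ _]] := uc (- c / 2)%R; first by lra.
suff : 0 <= \int[m]_x lip_a h x by move=> /le_trans/[apply]; rewrite lee_fin; lra.
by apply: integral_ge0 => x _; exact: lip_a_ge0.
Qed.

End relaxed_variation.

(** * Lower semicontinuity of the energy and sigma-finiteness *)

Section borel_measure.
Context {d : measure_display} {R : realType} {X : completeMetricMeasurableType d R}.
Variable m : {measure set X -> \bar R}.
Hypothesis hX : metric_measure_space m.
Implicit Types (f g h u : X -> R) (c e : R).
Local Open Scope ereal_scope.

Let hB : borel_space X. Proof. by have [] := hX. Qed.

Lemma measurable_LIP_locT h : LIP_loc setT h -> measurable_fun setT h.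
Proof. by move=> hh; apply: measurable_LIP_loc => //; exact: openT. Qed.

(** Diagonal argument: half of the error is spent on passing from [u] to [u'], half on approximating
    [u']. *)
Lemma variation_le_lsc u c : measurable_fun setT u ->
  (forall e, (0 < e)%R -> exists u' c', [/\ measurable_fun setT u',
     L1dist m u' u <= e%:E, (c' <= c + e)%R & variation_le m u' c']) ->
  variation_le m u c.
Proof.
move=> mu H e e0; have e2 : (0 < e / 2)%R by rewrite divr_gt0.
have [u' [c' [mu' u'u c'c u'c']]] := H _ e2.
have [h [hh hu' hc']] := u'c' _ e2.
exists h; split => //.
  have mh := measurable_LIP_locT hh.
  apply: le_trans (L1dist_triangle m mh mu' mu) _.
  by apply: le_trans (leeD hu' u'u) _; rewrite -EFinD -splitr.
by apply: le_trans hc' _; rewrite lee_fin; lra.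
Qed.

Lemma measurable_ball (x : X) r : measurable (ball x r).
Proof.
apply: (open_measurable_borel hB); apply: openP_ball => y /ball_in[s s0 sr].
by exists s.
Qed.

Lemma metric_measure_sigma_finite : sigma_finite setT m.
Proof.
have [_ _ mfin] := hX.
exists (fun n => ball (point : X) n%:R).
  apply/seteqP; split=> // x _.
  have /archi_boundP := mdist_ge0 (point : X) x.
  move=> H; exists (Num.bound (mdist (point : X) x)) => //.
  by rewrite ballEmdist.
move=> n; split; first exact: measurable_ball.
apply: mfin; first exact: measurable_ball.
exists (n%:R + n%:R)%R => x y; rewrite !ballEmdist /= => px py.
have := metric_triangle x point y; rewrite (metric_sym x point); lra.
Qed.

End borel_measure.

(** * Coarea inequality *)

Section coarea.
Context {d : measure_display} {R : realType} {X : completeMetricMeasurableType d R}.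
Variable m : {measure set X -> \bar R}.
Hypothesis hX : metric_measure_space m.
Implicit Types (f g h u : X -> R) (c e t : R).
Local Open Scope ereal_scope.

Let hB : borel_space X. Proof. by have [] := hX. Qed.

(* Density of the energy of h truncated to the slab t - 2e <= h <= t - e.  The
   offset from t makes these truncations, for h close to u, converge to the
   indicator of {t <= u} even if the level set {u = t} has positive measure. *)
Definition slab_density h (e : R) (z : X * R) : \bar R :=
  lip_a h z.1 * (e^-1 * \1_[set z : X * R | (z.2 - h z.1)%R \in `[e, (2 * e)%R]] z)%:E.

Definition slab_energy h e t := \int[m]_x slab_density h e (x, t).

Lemma slab_density_ge0 h e z : (0 < e)%R -> 0 <= slab_density h e z.
Proof.
by move=> e0; rewrite /slab_density mule_ge0 ?lip_a_ge0// lee_fin mulr_ge0// invr_ge0 ltW.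
Qed.

Lemma measurable_slab_density h e : LIP_loc setT h -> measurable_fun setT (slab_density h e).
Proof.
move=> hh; apply: emeasurable_funM.
  apply: (measurableT_comp (f := lip_a h : X -> \bar R)); last exact: measurable_fst.
  exact: measurable_lip_a.
apply/measurable_EFinP; apply: measurable_funM => //.
apply: measurable_indic.
rewrite (_ : [set _ | _] = setT `&` (fun z : X * R => (z.2 - h z.1)%R) @^-1` `[e, (2 * e)%R]%classic); last first.
  by rewrite setTI.
have : measurable_fun setT (fun z : X * R => (z.2 - h z.1)%R).
  apply: measurable_funB; first exact: measurable_snd.
  apply: (measurableT_comp (f := h : X -> R)); last exact: measurable_fst.
  exact: (measurable_LIP_locT hX).
by apply.
Qed.

Lemma slab_energy_ge0 h e t : (0 < e)%R -> 0 <= slab_energy h e t.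
Proof. by move=> e0; apply: integral_ge0 => x _; exact: slab_density_ge0. Qed.

(** Repackages [m] with the sigma-finite structure that Tonelli requires; agreement of the integrals
    is all that is used afterwards. *)
Lemma sigma_finite_measure_of : exists m' : {sigma_finite_measure set X -> \bar R},
  forall F : X -> \bar R, \int[m']_x F x = \int[m]_x F x.
Proof.
pose H1 := isSFinite.Build _ _ _ (Measure.sort m)
  (sfinite_measure_sigma_finite (metric_measure_sigma_finite hX)).
pose H2 := isSigmaFinite.Build _ _ _ (Measure.sort m) (metric_measure_sigma_finite hX).
pose m' := HB.pack_for (SigmaFiniteMeasure.type X R) (Measure.sort m) H1 H2.
exists m' => F.
by apply: eq_measure_integral.
Qed.

Lemma measurable_slab_energy h e : (0 < e)%R -> LIP_loc setT h ->
  measurable_fun setT (slab_energy h e).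
Proof.
move=> e0 hh; have [m' m'E] := sigma_finite_measure_of.
have -> : slab_energy h e = fubini_G m' (slab_density h e).
  by apply/funext => t; rewrite /slab_energy -m'E.
apply: measurable_fun_fubini_tonelli_G => [|z]; first exact: measurable_slab_density.
exact: slab_density_ge0.
Qed.

(** For fixed [x] the levels [t] whose slab contains [x] form an interval of length [e], which
    cancels the factor [e^-1]. Tonelli then gives an exact coarea identity for slabs. *)
Lemma integral_slab_energy h e : (0 < e)%R -> LIP_loc setT h ->
  \int[lebesgue_measure]_t slab_energy h e t = \int[m]_x lip_a h x.
Proof.
move=> e0 hh; have [m' m'E] := sigma_finite_measure_of.
rewrite /slab_energy; under eq_integral do rewrite -m'E.
rewrite -(fubini_tonelli (m1 := m') (m2 := lebesgue_measure) (slab_density h e)); last 2 first.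
  exact: measurable_slab_density.
  by move=> z; exact: slab_density_ge0.
rewrite -m'E; apply: eq_integral => x _.
have mI : measurable (`[(h x + e)%R, (h x + 2 * e)%R]%classic : set R) by [].
under eq_integral => t _.
  rewrite /slab_density /= EFinM.
  have -> : (\1_[set z : X * R | (z.2 - h z.1)%R \in `[e, (2 * e)%R]] (x, t) : R) = \1_(`[(h x + e)%R, (h x + 2 * e)%R]%classic) t.
    congr ((_ _)%:R); apply/idP/idP; rewrite !inE /= !in_itv /=; lra.
  over.
rewrite ge0_integralZl//=; last 3 first.
- by apply: emeasurable_funM => //; apply/measurable_EFinP; exact: measurable_indic.
- by move=> t _; rewrite mule_ge0// lee_fin// invr_ge0 ltW.
- exact: lip_a_ge0.
rewrite ge0_integralZl//=; last 2 first.
- by apply/measurable_EFinP; exact: measurable_indic.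
- by rewrite lee_fin invr_ge0 ltW.
rewrite integral_indic//= setIT.
have -> : lebesgue_measure (`[(h x + e)%R, (h x + 2 * e)%R]%classic : set R) = e%:E.
  rewrite lebesgue_measure_itv /= lte_fin ifT; last by lra.
  by rewrite -EFinD; congr (_%:E); lra.
by rewrite -EFinM mulVf ?gt_eqF// mule1.
Qed.

Definition clip (a : R) : R := Num.min 1%R (Num.max 0%R a).

Lemma clip_lip (a b : R) : (`|clip a - clip b| <= `|a - b|)%R.
Proof.
rewrite /clip; have := ler_norm (a - b)%R; have := lerNnormlW (lexx `|a - b|%R).
rewrite ler_norml; move: (`|_|%R) => n ? ?; apply/andP.
case: (leP 0%R a) => ?; case: (leP 0%R b) => ?; case: (leP 1%R a) => ?; case: (leP 1%R b) => ?;
  do ?case: (leP 1%R 0%R) => ?; by split; lra.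
Qed.

Lemma clip_itv a : (0 <= clip a <= 1)%R.
Proof. rewrite /clip; case: (leP 0%R a) => ?; case: (leP 1%R a) => ?;
  do ?case: (leP 1%R 0%R) => ?; by apply/andP; split; lra. Qed.

Lemma clip0 a : (a <= 0)%R -> clip a = 0%R.
Proof. by move=> a0; rewrite /clip max_l// min_r. Qed.

Lemma clip1 a : (1 <= a)%R -> clip a = 1%R.
Proof. by move=> a1; rewrite /clip max_r ?min_l//; lra. Qed.

Lemma LIP_loc_comp (A : set X) h (phi : R -> R) k : (0 < k)%R -> open A ->
  (forall a b, `|phi a - phi b| <= k * `|a - b|)%R ->
  LIP_loc A h -> LIP_loc A (phi \o h).
Proof.
move=> k0 oA kphi hA; apply: LIP_locP => // x Ax.
apply: le_lt_trans (lip_a_comp _ _ k0 kphi) _.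
by rewrite (lip_a_fineK (LIP_loc_lty hA Ax)) -EFinM ltry.
Qed.

(** Equal to 1 where [h >= t - e], to 0 where [h <= t - 2e], and affine in [h] in between: a
    Lipschitz substitute for the indicator of a superlevel set. *)
Definition slab_cut h e t x : R := clip ((h x - t + 2 * e) / e).

Lemma slab_affine_lip e t (a b : R) : (0 < e)%R ->
  (`|clip ((a - t + 2 * e) / e) - clip ((b - t + 2 * e) / e)| <= e^-1 * `|a - b|)%R.
Proof.
move=> e0; apply: le_trans (clip_lip _ _) _.
rewrite -mulrBl normrM (ger0_norm (x := e^-1)); last by rewrite invr_ge0 ltW.
rewrite [leRHS]mulrC.
rewrite ler_pM2r ?invr_gt0// (_ : (_ - _ = a - b)%R)//; lra.
Qed.

Lemma LIP_loc_slab_cut h e t : (0 < e)%R -> LIP_loc setT h -> LIP_loc setT (slab_cut h e t).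
Proof.
move=> e0 hh; have oT : open (setT : set X) by exact: openT.
apply: (@LIP_loc_comp setT h (fun a => clip ((a - t + 2 * e) / e))%R (e^-1)%R) => //.
  by rewrite invr_gt0.
by move=> a b; exact: slab_affine_lip.
Qed.

Lemma open_LIP_loc_lt h c : LIP_loc setT h -> open [set x | (h x < c)%R].
Proof.
move=> hh; rewrite -[X in open X]setTI; apply: LIP_loc_open_lt => //; exact: openT.
Qed.

Lemma LIP_locN h (A : set X) : open A -> LIP_loc A h -> LIP_loc A (fun x => - h x)%R.
Proof.
move=> oA; apply: (@LIP_loc_comp A h -%R 1%R ltr01 oA) => a b /=.
by rewrite mul1r -opprD normrN.
Qed.

Lemma open_LIP_loc_gt h c : LIP_loc setT h -> open [set x | (c < h x)%R].
Proof.
move=> /(LIP_locN openT)/(@open_LIP_loc_lt _ (- c)%R).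
by congr open; apply/seteqP; split=> x /=; rewrite ltrN2.
Qed.

(** The slab is closed, so off it the cut is constant on a neighbourhood; on it the affine profile
    has slope [e^-1]. *)
Lemma lip_a_slab_cut h e t x : (0 < e)%R -> LIP_loc setT h ->
  lip_a (slab_cut h e t) x <= slab_density h e (x, t).
Proof.
move=> e0 hh; rewrite /slab_density /=.
have [|H] := boolP ((t - h x)%R \in `[e, (2 * e)%R]).
  move=> tI; rewrite indicE mem_set//= mulr1 muleC.
  apply: (@lip_a_comp _ _ _ h _ (fun a => clip ((a - t + 2 * e) / e))%R).
    by rewrite invr_gt0.
  by move=> a b; exact: slab_affine_lip.
rewrite indicE memNset//=; last exact/negP.
rewrite mulr0 mule0.
have : (t - e < h x)%R \/ (h x < t - 2 * e)%R.
  move: H; rewrite in_itv /= negb_and -!ltNge => /orP[]; [left|right]; lra.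
have cst a : nbhs x [set y | slab_cut h e t y = a] -> lip_a (slab_cut h e t) x <= 0.
  move=> /nbhs_ballP[r /= r0 rA]; rewrite (lip_a_cst0 (a := a) r0)// => y By; exact: rA.
case=> hx.
- apply: (cst 1%R); apply: filterS (open_nbhs_nbhs (conj (open_LIP_loc_gt (t - e)%R hh) hx)) => y /= hy.
  by rewrite /slab_cut clip1// ler_pdivlMr// mul1r; lra.
- apply: (cst 0%R); apply: filterS (open_nbhs_nbhs (conj (open_LIP_loc_lt (t - 2 * e)%R hh) hx)) => y /= hy.
  by rewrite /slab_cut clip0// pmulr_lle0 ?invr_gt0//; lra.
Qed.

Lemma integral_lip_a_slab_cut h e t : (0 < e)%R -> LIP_loc setT h ->
  \int[m]_x lip_a (slab_cut h e t) x <= slab_energy h e t.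
Proof.
move=> e0 hh; apply: ge0_le_integral => //.
- by move=> x _; exact: lip_a_ge0.
- exact: measurable_lip_a.
- by apply: (measurableT_comp (f := slab_density h e)); [exact: measurable_slab_density|exact: measurable_pair2].
- by move=> x _; exact: lip_a_slab_cut.
Qed.

(** The cut and the indicator agree unless [|h - u| >= e], where the quotient is at least 1, or [u]
    lies in [[t - 3e, t[]: the slab reaches down to [t - 2e], and one more [e] allows for the error
    of [h]. Since [3e < t], [u] is positive on that strip, which therefore lies in [A]. *)
Lemma slab_cut_dist h u e t (A : set X) x : (0 < e)%R -> (3 * e < t)%R ->
  (forall x, ~ A x -> u x <= 0)%R ->
  (`|slab_cut h e t x - \1_[set x | t <= u x] x| <=
   `|h x - u x| / e + \1_(A `&` [set x | (t - 3 * e <= u x) && (u x < t)]) x)%R.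
Proof.
move=> e0 et uA.
have /andP[w0 w1] := clip_itv ((h x - t + 2 * e) / e).
have far : (e <= `|h x - u x|)%R -> (1 <= `|h x - u x| / e)%R.
  by move=> H; rewrite ler_pdivlMr// mul1r.
have q0 : (0 <= `|h x - u x| / e)%R by rewrite divr_ge0// ltW.
rewrite -/(slab_cut h e t x) in w0 w1 *.
have [tu|ut] := leP t (u x).
  have -> : \1_[set x | (t <= u x)%R] x = 1%R :> R by rewrite indicE mem_set.
  set i := \1_ _ _.
  have i0 : (0 <= i)%R by rewrite /i indicE.
  have [hx|hx] := leP (t - e)%R (h x).
    rewrite /slab_cut clip1 ?subrr ?normr0 ?addr_ge0//.
    by rewrite ler_pdivlMr// mul1r; lra.
  have {}far : (1 <= `|h x - u x| / e)%R.
    by apply: far; rewrite distrC ger0_norm; lra.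
  apply: (@le_trans _ _ 1%R); last by lra.
  by rewrite ler_norml; apply/andP; split; lra.
have -> : \1_[set x | (t <= u x)%R] x = 0%R :> R.
  by rewrite indicE memNset//= leNgt ut.
rewrite subr0.
rewrite ger0_norm//.
have [ux|ux] := leP (t - 3 * e)%R (u x).
  rewrite indicE mem_set/=; first by rewrite (le_trans w1)// lerDr.
  split; last by rewrite ux.
  by apply: contrapT => /uA; lra.
set i := \1_ _ _; have i0 : (0 <= i)%R by rewrite /i indicE.
have [hx|hx] := leP (h x) (t - 2 * e)%R.
  rewrite /slab_cut clip0 ?addr_ge0//.
  by rewrite pmulr_lle0 ?invr_gt0//; lra.
apply: (le_trans w1); rewrite (le_trans (far _)) ?lerDl//.
by rewrite ger0_norm; lra.
Qed.
End coarea.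

Section coarea_inequality.
Context {d : measure_display} {R : realType} {X : completeMetricMeasurableType d R}.
Variable m : {measure set X -> \bar R}.
Hypothesis hX : metric_measure_space m.
Implicit Types (f g h u : X -> R) (c e t : R).
Local Open Scope ereal_scope.

Let hB : borel_space X. Proof. by have [] := hX. Qed.

Lemma measurable_superlevel u t : measurable_fun setT u -> measurable [set x | (t <= u x)%R].
Proof.
move=> mu; rewrite (_ : [set x | _] = setT `&` u @^-1` `[t, +oo[%classic); first exact: mu.
by rewrite setTI; apply/seteqP; split=> x /=; rewrite in_itv /= andbT.
Qed.

Lemma measurable_sublevel u t : measurable_fun setT u -> measurable [set x | (u x < t)%R].
Proof.
move=> mu; rewrite (_ : [set x | _] = setT `&` u @^-1` `]-oo, t[%classic); first exact: mu.
by rewrite setTI; apply/seteqP; split=> x /=; rewrite in_itv /=.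
Qed.

Lemma measurable_strip (A : set X) u s t : measurable A -> measurable_fun setT u ->
  measurable (A `&` [set x | (s <= u x) && (u x < t)]%R).
Proof.
move=> mA mu; rewrite (_ : [set x | _] = [set x | (s <= u x)%R] `&` [set x | (u x < t)%R]).
  by do 2?apply: measurableI => //; [exact: measurable_superlevel|exact: measurable_sublevel].
by apply/seteqP; split=> x /=; [move=> /andP[]|move=> [-> ->]].
Qed.

Let dl (n : nat) : R := n.+1%:R^-1.

Let dl_gt0 n : (0 < dl n)%R. Proof. by rewrite /dl invr_gt0. Qed.

Let dl_le1 n : (dl n <= 1)%R. Proof. by rewrite /dl invf_le1 ?ler1n. Qed.

Let dl_near e : (0 < e)%R -> \forall n \near \oo, (dl n < e)%R.
Proof. by move=> e0; exact: near_infty_natSinv_lt (PosNum e0). Qed.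

(** The strips exclude the level [t] itself, so they decrease to the empty set; finiteness of [m A]
    gives continuity from above. *)
Lemma cvg_measure_thin_slab u (A : set X) t : measurable_fun setT u -> measurable A ->
  m A < +oo ->
  (fun n => m (A `&` [set x | (t - 3 * dl n <= u x) && (u x < t)]%R)) @ \oo --> 0.
Proof.
move=> mu mA Afin.
set F := fun n => _.
pose B n := A `&` [set x | (t - 3 * dl n <= u x) && (u x < t)]%R.
have mB n : measurable (B n) by exact: measurable_strip.
have B0 : \bigcap_n B n = set0.
  rewrite -subset0 => x Bx.
  have [_ /= /andP[_ xt]] := Bx 0%N I.
  have s0 : (0 < (t - u x) / 3)%R by lra.
  have [N _ HN] := dl_near s0.
  have [_ /= /andP[]] := Bx N I; have := HN N (leqnn _) => /=; lra.
rewrite -[0](measure0 m) -B0.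
apply: nonincreasing_cvg_mu.
- apply: le_lt_trans Afin; apply: le_measure.
  + by rewrite inE; exact: (mB 0%N).
  + by rewrite inE.
  + exact: subIsetl.
- exact: mB.
- by rewrite B0.
- move=> i j ij; apply/subsetPset => x [Ax /= /andP[tx xt]]; split=> //=.
  rewrite xt andbT; apply: le_trans tx.
  by rewrite lerD2l lerN2 ler_pM2l// /dl lef_pV2 ?posrE// ler_nat ltnS.
Qed.

(* D is the liminf of the slab energies of approximations h_n with slab width
   1/(n+1) and |h_n - u|_1 <= 1/(n+1)^2; Tonelli and Fatou bound its integral. *)
Lemma variation_le_coarea u c (A : set X) : measurable_fun setT u -> measurable A ->
  m A < +oo -> (forall x, ~ A x -> u x <= 0)%R -> variation_le m u c ->
  exists D : R -> \bar R, [/\ measurable_fun setT D, forall t, 0 <= D t,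
    \int[lebesgue_measure]_t D t <= c%:E &
    forall t c', (0 < t)%R -> D t <= c'%:E ->
      variation_le m \1_[set x | (t <= u x)%R] c'].
Proof.
move=> mu mA Afin uA uc.
(* The quadratic error still tends to 0 after the division by the slab width in [slab_cut_dist]. *)
have dl2 n : (0 < dl n * dl n)%R by rewrite mulr_gt0.
have [h Hh] := choice (fun n => uc _ (dl2 n)).
have hh n : LIP_loc setT (h n) by have [] := Hh n.
pose En n t := slab_energy m (h n) (dl n) t.
have mE n : measurable_fun setT (En n) by exact: measurable_slab_energy.
have E0 n t : 0 <= En n t by exact: slab_energy_ge0.
exists (fun t => limn_einf (En ^~ t)); split.
- apply: measurableT_comp => //.
  apply: (@measurable_fun_limn_esup _ _ _ _ (fun n t => - En n t)) => n.
  exact: measurableT_comp.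
- by move=> t; apply: (@limn_einf_ge _ _ _ 0).
- apply: le_trans (fatou lebesgue_measure measurableT mE (fun n x _ => E0 n x)) _.
  apply: limn_einf_le => e N e0; have [M _ HM] := dl_near e0.
  exists (maxn N M); first exact: leq_maxl.
  rewrite integral_slab_energy//; have [_ _ H] := Hh (maxn N M).
  apply: le_trans H _; rewrite lee_fin lerD2l.
  have := HM (maxn N M) (leq_maxr _ _) => /= /ltW; apply: le_trans.
  by rewrite ger_pMl.
move=> t c' t0 Dt e e0.
have e2 : (0 < e / 2)%R by rewrite divr_gt0.
have t3 : (0 < t / 3)%R by rewrite divr_gt0.
have [N1 _ H1] := dl_near e2.
have [N2 _ H2] := dl_near t3.
have [N3 _ H3] : \forall n \near \oo, m (A `&` [set x | (t - 3 * dl n <= u x) && (u x < t)]%R) < (e / 2)%:E.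
  have := cvg_measure_thin_slab t mu mA Afin.
  move=> /(_ [set y | y < (e / 2)%:E]); apply.
  by apply: open_nbhs_nbhs; split; [exact: open_ereal_lt_ereal|rewrite /= lte_fin].
have [n Nn En_le] := limn_einf_frequently (maxn N1 (maxn N2 N3)) Dt e0.
have [nN1 nN2 nN3] : [/\ (N1 <= n)%N, (N2 <= n)%N & (N3 <= n)%N].
  by move: Nn; rewrite !geq_max => /andP[? /andP[? ?]].
have {H1} /= H1 := H1 n nN1; have {H2} /= H2 := H2 n nN2; have {H3} /= H3 := H3 n nN3.
exists (slab_cut (h n) (dl n) t); split; first exact: LIP_loc_slab_cut.
  set B := A `&` _ in H3.
  have mB : measurable B by exact: measurable_strip.
  have mh := measurable_LIP_locT hX (hh n).
  apply: (@le_trans _ _ (\int[m]_x ((dl n)^-1%:E * `|h n x - u x|%:E + (\1_B x)%:E))).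
    apply: ge0_le_integral => //.
    - apply: measurable_abs_sub; first exact: (measurable_LIP_locT hX (LIP_loc_slab_cut _ _ _)).
      by apply: measurable_indic; exact: measurable_superlevel.
    - apply: emeasurable_funD; last by apply/measurable_EFinP; exact: measurable_indic.
      by apply: emeasurable_funM => //; exact: measurable_abs_sub.
    - move=> x _; rewrite -EFinM -EFinD lee_fin mulrC; apply: slab_cut_dist => //.
      by lra.
  have mhu : measurable_fun setT (fun x => `|h n x - u x|%:E) by exact: measurable_abs_sub.
  have dl0 : 0 <= ((dl n)^-1)%:E by rewrite lee_fin invr_ge0 ltW.
  have F0 x : setT x -> 0 <= (dl n)^-1%:E * `|h n x - u x|%:E.
    by move=> _; rewrite mule_ge0// lee_fin.
  have mF : measurable_fun setT (fun x => (dl n)^-1%:E * `|h n x - u x|%:E).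
    exact: emeasurable_funM.
  have G0 x : setT x -> 0 <= (\1_B x)%:E :> \bar R by rewrite lee_fin.
  have mG : measurable_fun setT (fun x => (\1_B x)%:E : \bar R).
    by apply/measurable_EFinP; exact: measurable_indic.
  have hu0 x : setT x -> 0 <= `|h n x - u x|%:E by rewrite lee_fin.
  rewrite (ge0_integralD m measurableT F0 mF G0 mG).
  rewrite (ge0_integralZl m measurableT mhu hu0 dl0) integral_indic// setIT.
  have [_ Hd _] := Hh n.
  apply: (@le_trans _ _ ((dl n)%:E + (e / 2)%:E)); last by rewrite -EFinD lee_fin; lra.
  apply: leeD; last exact: ltW.
  rewrite lee_pdivrMl// -EFinM; exact: Hd.
by apply: le_trans (integral_lip_a_slab_cut hX _ _ _) En_le.
Qed.

End coarea_inequality.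

(** * Minimal compact sets *)

Section ekeland.
Context {d : measure_display} {R : realType} {X : completeMetricMeasurableType d R}.
Variable m : {measure set X -> \bar R}.
Hypothesis hX : metric_measure_space m.
Implicit Types (K : set X) (c e : R).
Local Open Scope ereal_scope.

Let hB : borel_space X. Proof. by have [] := hX. Qed.

Lemma compact_measurable K : compact K -> measurable K.
Proof.
by move=> /(compact_closed (@metric_hausdorff _ X)); exact: closed_measurable_borel.
Qed.

Lemma L1dist_indic (A B : set X) : measurable A -> measurable B -> B `<=` A ->
  L1dist m \1_A \1_B = m (A `\` B).
Proof.
move=> mA mB BA; rewrite /L1dist -(setIT (A `\` B)) -integral_indic//; last exact: measurableD.
apply: eq_integral => x _; congr (_%:E); rewrite !indicE.
have [xB|xB] := boolP (x \in B).
  have xA : x \in A by move: xB; rewrite !inE; exact: BA.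
  by rewrite xA subrr normr0 memNset// => -[_]; rewrite inE in xB.
have [xA|xA] := boolP (x \in A).
  by rewrite mem_set ?subr0 ?normr1//; split; [rewrite inE in xA|move=> /mem_set; rewrite (negbTE xB)].
by rewrite memNset ?subr0 ?normr0// => -[/mem_set]; rewrite (negbTE xA).
Qed.

(** This inequality makes the order used in the descent below transitive. *)
Lemma fine_measureD_triangle (K0 A B C : set X) : measurable K0 -> m K0 < +oo ->
  measurable A -> measurable B -> measurable C -> A `<=` K0 -> B `<=` K0 ->
  (fine (m (A `\` C)) <= fine (m (A `\` B)) + fine (m (B `\` C)))%R.
Proof.
move=> mK0 K0fin mA mB mC AK BK.
have fin (D E : set X) : measurable D -> measurable E -> D `<=` K0 -> m (D `\` E) \is a fin_num.
  move=> mD mE DK; rewrite ge0_fin_numE//; apply: le_lt_trans K0fin.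
  apply: le_measure; rewrite ?inE//; first exact: measurableD.
  exact: subset_trans (@subDsetl _ _ _) DK.
rewrite -lee_fin EFinD !fineK ?fin//.
apply: (@le_trans _ _ (m ((A `\` B) `|` (B `\` C)))).
  apply: le_measure; rewrite ?inE; do ?[exact: measurableD|exact: measurableU].
    by apply: measurableU; exact: measurableD.
  by move=> x [Ax Cx]; have [Bx|Bx] := pselect (B x); [right|left].
by apply: measureU2; exact: measurableD.
Qed.

(* No compactness in BV is available: exact minimality against compact subsets is
   obtained from an Ekeland-type descent in which only decreasing sequences of
   compact sets occur. *)
Lemma minimal_compact_subset (K0 : set X) c0 (lam : R) : (0 < lam)%R ->
  compact K0 -> m K0 < +oo -> variation_le m \1_K0 c0 ->
  exists K c, [/\ compact K, K `<=` K0, variation_le m \1_K c,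
    (c + lam * fine (m (K0 `\` K)) <= c0)%R &
    forall K' c', compact K' -> K' `<=` K -> variation_le m \1_K' c' ->
      (c <= c' + lam * fine (m (K `\` K')))%R].
Proof.
move=> lam0 cK0 K0fin v0.
have mK0 := compact_measurable cK0.
pose mu A := fine (m A).
have mu0 A : (0 <= mu A)%R by rewrite /mu fine_ge0.
(* States of the descent: a compact subset together with an admissible energy bound for it. *)
pose P (p : set X * R) := [/\ compact p.1, p.1 `<=` K0 & variation_le m \1_(p.1) p.2].
(* The Ekeland order: the removed mass, weighted by [lam], must be paid for by a drop of the energy
   bound. *)
pose rel (p q : set X * R) := q.1 `<=` p.1 /\ (q.2 + lam * mu (p.1 `\` q.1) <= p.2)%R.
have rel_refl p : rel p p by split=> //; rewrite setDv /mu measure0 mulr0 addr0.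
have rel_trans p q r : P p -> P q -> P r -> rel p q -> rel q r -> rel p r.
  move=> [cp pK _] [cq qK _] [cr rK _] [qp pq] [rq qr]; split; first exact: subset_trans qp.
  have := fine_measureD_triangle mK0 K0fin (compact_measurable cp)
    (compact_measurable cq) (compact_measurable cr) pK qK.
  rewrite -/(mu _) -/(mu _) -/(mu _) -(ler_pM2l lam0) mulrDr; lra.
pose S p := [set q.2 | q in [set q | P q /\ rel p q]].
have lbS p : has_lbound (S p).
  by exists 0%R => _ [q [[_ _ /variation_le_ge0 q0] _] <-].
pose dl (n : nat) : R := (n.+1%:R^-1)%R.
have dl0 n : (0 < dl n)%R by rewrite invr_gt0.
(* Keeping [P] as a premise under the existential makes the statement total, so that [choice] yields
   one function [F]. The index in the pair sets how close to the infimum the next bound has to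
   be. *)
have step (np : nat * (set X * R)) : exists q, P np.2 ->
    [/\ P q, rel np.2 q & (q.2 <= inf (S np.2) + dl np.1)%R].
  case: np => n p /=; have [Pp|nPp] := pselect (P p); last by exists p.
  have hS : has_inf (S p) by split; [exists p.2; exists p|exact: lbS].
  have [_ [q [Pq pq] <-] /ltW qinf] := inf_adherent (dl0 n) hS.
  by exists q.
have [F HF] := choice step.
pose s := fix s (n : nat) : set X * R := if n is k.+1 then F (k, s k) else (K0, c0).
have Ps n : P (s n).
  by elim: n => [|n IH] /=; [split|have [] := HF (n, s n) IH].
have rels n : rel (s n) (s n.+1) by have [] := HF (n, s n) (Ps n).
have infs n : ((s n.+1).2 <= inf (S (s n)) + dl n)%R by have [] := HF (n, s n) (Ps n).
have relss n k : (n <= k)%N -> rel (s n) (s k).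
  move=> /subnK <-; elim: (k - n)%N => [|j IH] /=; first by rewrite add0n.
  by apply: rel_trans IH (rels _).
have cs n : compact (s n).1 by have [] := Ps n.
have ms n : measurable (s n).1 by exact: compact_measurable.
have sK0 n : (s n).1 `<=` K0 by have [] := Ps n.
(* The limit of the descent. The indicators of the decreasing compact sets converge to that of [K]
   in L^1 by continuity from above, so lower semicontinuity gives [K] the infimum [c] of the
   bounds. *)
pose K := \bigcap_n (s n).1.
have KK n : K `<=` (s n).1 by move=> x /(_ n I).
have cK : compact K.
  apply: (subclosed_compact _ cK0); last exact: subset_trans (KK 0%N) (sK0 0%N).
  apply: closed_bigI => n _; exact: compact_closed (@metric_hausdorff _ X) _.
have mK := compact_measurable cK.
pose c := inf (range (fun n => (s n).2)).
have hinf : has_inf (range (fun n => (s n).2)).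
  split; first by exists (s 0%N).2; exists 0%N.
  by exists 0%R => _ [n _ <-]; have [_ _ /variation_le_ge0] := Ps n.
have cle n : (c <= (s n).2)%R by apply: ge_inf; [exact: hinf.2|exists n].
have snfin n : m ((s n).1 `\` K) \is a fin_num.
  rewrite ge0_fin_numE//; apply: le_lt_trans K0fin.
  apply: le_measure; rewrite ?inE//; first exact: measurableD.
  exact: subset_trans (@subDsetl _ _ _) (sK0 n).
have small e N : (0 < e)%R -> exists n, [/\ (N <= n)%N, (mu ((s n).1 `\` K) <= e)%R & ((s n).2 <= c + e)%R].
  move=> e0; have [_ [n1 _ <-] /ltW cn1] := inf_adherent e0 hinf.
  have H : (fun n => m ((s n).1 `\` K)) @ \oo --> 0.
    have I0 : \bigcap_n ((s n).1 `\` K) = set0.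
      by rewrite -subset0 => x H; have [_] := H 0%N I; apply=> n _; have [] := H n I.
    rewrite -[0](measure0 m) -I0; apply: nonincreasing_cvg_mu.
    - by have := snfin 0%N; rewrite ge0_fin_numE.
    - by move=> n; exact: measurableD.
    - by rewrite I0.
    - move=> i j /relss[ji _]; apply/subsetPset; exact: setSD.
  have [n2 _ Hn2] : \forall n \near \oo, m ((s n).1 `\` K) < e%:E.
    move: H => /(_ [set y | y < e%:E]); apply.
    by apply: open_nbhs_nbhs; split; [exact: open_ereal_lt_ereal|rewrite /= lte_fin].
  exists (maxn N (maxn n1 n2)); split; first exact: leq_maxl.
    rewrite -lee_fin /mu fineK ?snfin// ltW//; apply: Hn2 => /=.
    by rewrite (leq_trans (leq_maxr n1 n2))// leq_maxr.
  have [|_] := relss n1 (maxn N (maxn n1 n2)).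
    by rewrite (leq_trans (leq_maxl n1 n2))// leq_maxr.
  have := mulr_ge0 (ltW lam0) (mu0 ((s n1).1 `\` (s (maxn N (maxn n1 n2))).1)).
  rewrite /= in cn1; rewrite /c; lra.
have vK : variation_le m \1_K c.
  apply: (variation_le_lsc hX) => [|e e0]; first exact: measurable_indic.
  have [n [_ mun cn]] := small e 0%N e0.
  exists \1_((s n).1), (s n).2; split=> //.
    by rewrite L1dist_indic// -(fineK (snfin n)) lee_fin.
  by have [] := Ps n.
have PK : P (K, c) by split=> //=; exact: subset_trans (KK 0%N) (sK0 0%N).
(* The mass of [(s n).1] outside [K] is split at a late [(s k).1], whose own excess over [K] is
   negligible. *)
have relK n : rel (s n) (K, c).
  split; first exact: KK.
  apply/ler_addgt0Pr => e e0 /=.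
  have el : (0 < e / lam)%R by rewrite divr_gt0.
  have [k [nk muk _]] := small _ n el.
  have [_ nk2] := relss _ _ nk.
  have := fine_measureD_triangle mK0 K0fin (ms n) (ms k) mK (sK0 n) (sK0 k).
  rewrite -/(mu _) -/(mu _) -/(mu _) -(ler_pM2l lam0) mulrDr.
  have : (lam * mu ((s k).1 `\` K) <= e)%R by rewrite mulrC -ler_pdivlMr.
  have := cle k; rewrite /=; lra.
have s0 : s 0%N = (K0, c0) by [].
exists K, c; split => //; first exact: subset_trans (KK 0%N) (sK0 0%N).
  by have [] := relK 0%N.
move=> K' c' cK' K'K vK'; rewrite leNgt; apply/negP => lt.
have PK' : P (K', c') by split=> //=; apply: (subset_trans K'K); exact: subset_trans (KK 0%N) (sK0 0%N).
(* A violation of minimality places [(K', c')] below the limit, hence below every state. It was then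
   a competitor at every step, and the nearly optimal choices force [c <= c'], a contradiction. *)
have relK' n : rel (s n) (K', c').
  apply: rel_trans (Ps n) PK PK' (relK n) _; split=> //=.
  exact: ltW.
have cc' : (c <= c')%R.
  apply/ler_addgt0Pr => e e0.
  have [N _ HN] := near_infty_natSinv_lt (PosNum e0).
  have := HN N (leqnn _) => /= dN.
  have := infs N; have := cle N.+1.
  have : (inf (S (s N)) <= c')%R by apply: ge_inf; [exact: lbS|exists (K', c')].
  rewrite -/(dl N) in dN; lra.
have := mulr_ge0 (ltW lam0) (mu0 (K `\` K')); rewrite /mu in lt *; lra.
Qed.

End ekeland.

(** * Energy of products with the indicator of a minimal compact set *)

Section minimal_set.
Context {d : measure_display} {R : realType} {X : completeMetricMeasurableType d R}.
Variable m : {measure set X -> \bar R}.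
Hypothesis hX : metric_measure_space m.
Variables (K : set X) (c lam : R).
Hypotheses (lam0 : (0 < lam)%R) (cK : compact K) (Kfin : (m K < +oo)%E)
  (vK : variation_le m \1_K c)
  (Kmin : forall K' c', compact K' -> K' `<=` K -> variation_le m \1_K' c' ->
    (c <= c' + lam * fine (m (K `\` K')))%R).
Implicit Types (f g h u : X -> R) (e t : R).
Local Open Scope ereal_scope.

Let hB : borel_space X. Proof. by have [] := hX. Qed.
Let mK : measurable K. Proof. exact: (compact_measurable hX). Qed.

(** Tonelli on the region [u x < t < M] over [K], whose section at [x] has length [M - u x]. *)
Lemma integral_sublevel_measure u (M : R) : measurable_fun setT u ->
  (forall x, K x -> 0 <= u x <= M)%R ->
  exists Q : R -> \bar R, [/\ measurable_fun setT Q, forall t, 0 <= Q t,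
    forall t, (t < M)%R -> Q t = m (K `&` [set x | (u x < t)%R]) &
    \int[lebesgue_measure]_t Q t = \int[m]_(x in K) (M - u x)%:E].
Proof.
move=> mu uM; have [m' m'E] := sigma_finite_measure_of hX.
pose W := [set z : X * R | K z.1 /\ (u z.1 < z.2 < M)%R].
have mW : measurable W.
  have -> : W = (K `*` `]-oo, M[%classic) `&` (setT `&` (fun z : X * R => (z.2 - u z.1)%R) @^-1` `]0%R, +oo[%classic).
    apply/seteqP; split=> -[x t] /=; rewrite /W /= !in_itv /= ?andbT subr_gt0.
      by move=> [? /andP[]].
    by move=> [[? ?] [_ ?]]; split=> //; apply/andP.
  apply: measurableI; first exact: measurableX.
  have : measurable_fun setT (fun z : X * R => (z.2 - u z.1)%R).
    apply: measurable_funB; first exact: measurable_snd.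
    by apply: (measurableT_comp (f := u : X -> R)); last exact: measurable_fst.
  by apply.
pose G := fun z : X * R => (\1_W z)%:E : \bar R.
have mG : measurable_fun setT G by apply/measurable_EFinP; exact: measurable_indic.
have G0 z : 0 <= G z by rewrite lee_fin.
exists (fubini_G m' G); split.
- exact: measurable_fun_fubini_tonelli_G.
- by move=> t; apply: integral_ge0.
- move=> t tM; rewrite /fubini_G m'E /G /=.
  have mB : measurable (K `&` [set x | (u x < t)%R]).
    by apply: measurableI => //; exact: measurable_sublevel.
  rewrite -[in RHS](setIT (K `&` [set x | (u x < t)%R])) -integral_indic//; apply: eq_integral => x _.
  congr (_%:E); rewrite !indicE; congr ((_ _)%:R).
  by apply/idP/idP; rewrite !inE /W /= tM andbT.
rewrite -(fubini_tonelli2 (m1 := m') (m2 := lebesgue_measure) G)// fubini_tonelli1//.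
rewrite m'E [RHS]integral_mkcond; apply: eq_integral => x _.
rewrite /fubini_F /G patchE; case: ifPn => xK; last first.
  rewrite (_ : (fun t => _) = cst 0) ?integral0//; apply/funext => t.
  by rewrite indicE memNset// => -[/mem_set]; rewrite (negbTE xK).
rewrite inE in xK; have /andP[u0 uxM] := uM x xK.
have mI : measurable (`]u x, M[%classic : set R) by [].
rewrite (_ : (fun t => _) = (fun t => (\1_(`]u x, M[%classic : set R) t)%:E)).
  rewrite integral_indic//= setIT lebesgue_measure_itv /= lte_fin.
  case: ltP => // Mu; congr (_%:E); lra.
apply/funext => t; congr (_%:E); rewrite !indicE; congr ((_ _)%:R).
by apply/idP/idP; rewrite !inE /W /= in_itv /=; [move=> []|].
Qed.

(* Integrating the minimality of K against the superlevel sets of u over the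
   levels in ]0, M[. *)
Lemma minimal_energy_lower_bound u (M c' : R) : (0 < M)%R -> measurable_fun setT u ->
  (forall x, ~ K x -> u x = 0)%R -> (forall x, K x -> 0 <= u x <= M)%R ->
  (forall t, (0 < t)%R -> compact [set x | (t <= u x)%R]) ->
  variation_le m u c' ->
  (M * c)%:E <= c'%:E + lam%:E * \int[m]_(x in K) (M - u x)%:E.
Proof.
move=> M0 mu u0 uM cu vu.
have uA x : ~ K x -> (u x <= 0)%R by move=> /u0 ->.
have [D [mD D0 iD DE]] := variation_le_coarea hX mu mK Kfin uA vu.
have [Q [mQ Q0 QE iQ]] := integral_sublevel_measure mu uM.
pose I := `]0%R, M[%classic : set R.
have mI : measurable I by exact: measurable_itv.
have lvl t : I t -> c%:E <= D t + lam%:E * Q t.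
  rewrite /I /= in_itv /= => /andP[t0 tM].
  have Qfin : Q t \is a fin_num.
    rewrite ge0_fin_numE// QE//; apply: le_lt_trans Kfin.
    apply: le_measure; rewrite ?inE//.
    by apply: measurableI => //; exact: measurable_sublevel.
  have [Dfin|] := ltP (D t) +oo; last first.
    rewrite leye_eq => /eqP ->; rewrite addye ?leey//.
    by rewrite -(fineK Qfin) -EFinM.
  have DF : D t = (fine (D t))%:E by rewrite fineK// ge0_fin_numE.
  have tK : [set x | (t <= u x)%R] `<=` K.
    by move=> x /=; apply: contraPP => /u0 ->; lra.
  have v := DE t (fine (D t)) t0 ltac:(by rewrite -DF).
  have := Kmin (cu t t0) tK v.
  have -> : K `\` [set x | (t <= u x)%R] = K `&` [set x | (u x < t)%R].
    by apply/seteqP; split=> x [Kx /=]; [move=> /negP; rewrite -ltNge|rewrite ltNge => /negP].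
  by rewrite -QE// DF -(fineK Qfin) -EFinM -EFinD lee_fin.
have mDI : measurable_fun I D by exact: measurable_funTS.
have mQI : measurable_fun I Q by exact: measurable_funTS.
have mlQI : measurable_fun I (fun t => lam%:E * Q t) by exact: measurable_funeM.
have lQ0 t : I t -> 0 <= lam%:E * Q t by move=> _; rewrite mule_ge0// lee_fin ltW.
apply: (@le_trans _ _ (\int[lebesgue_measure]_(t in I) (D t + lam%:E * Q t))).
  apply: (@le_trans _ _ (\int[lebesgue_measure]_(t in I) c%:E)).
    rewrite integral_cst//= lebesgue_measure_itv /= lte_fin M0 -EFinD subr0.
    by rewrite -EFinM mulrC.
  apply: ge0_le_integral => //.
  - by move=> t _; rewrite lee_fin; exact: variation_le_ge0 vK.
  - exact: emeasurable_funD.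
rewrite ge0_integralD//.
apply: leeD.
  by apply: le_trans iD; apply: ge0_subset_integral.
rewrite ge0_integralZl//; last by rewrite lee_fin ltW.
rewrite -iQ; apply: lee_wpmul2l; first by rewrite lee_fin ltW.
by apply: ge0_subset_integral.
Qed.

Lemma integral_compact_fin f (L : R) : measurable_fun K f -> (forall x, K x -> 0 <= f x <= L)%R ->
  \int[m]_(x in K) (f x)%:E \is a fin_num.
Proof.
move=> mf f0L; rewrite ge0_fin_numE; last first.
  by apply: integral_ge0 => x Kx; rewrite lee_fin; have /andP[] := f0L x Kx.
apply: (@le_lt_trans _ _ (\int[m]_(x in K) L%:E)).
  apply: ge0_le_integral => //.
  - by move=> x Kx; rewrite lee_fin; have /andP[] := f0L x Kx.
  - exact/measurable_EFinP.
  - by move=> x Kx; rewrite lee_fin; have /andP[] := f0L x Kx.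
rewrite integral_cst//= -(fineK (x := m K)) ?ge0_fin_numE// -EFinM; exact: ltry.
Qed.

Lemma sub_norm_lip (M a b : R) : (`|(M - `|a|) - (M - `|b|)| <= `|a - b|)%R.
Proof.
have -> : (M - `|a| - (M - `|b|) = `|b| - `|a|)%R by lra.
rewrite [leRHS]distrC; exact: ler_dist_dist.
Qed.

(** In the two product rules the coefficients [|f|] and [M - |f|] of [lip_a g] add up to [M], while
    each product contributes [g] times [lip_a f] at most once because the absolute value is
    1-Lipschitz. *)
Lemma lip_a_mul_complement f g (M : R) x : LIP_loc setT f -> LIP_loc setT g ->
  (`|f x| <= M)%R -> (0 <= g x)%R ->
  lip_a (fun y => f y * g y)%R x + lip_a (fun y => (M - `|f y|) * g y)%R x <=
    M%:E * lip_a g x + 2%:E * ((g x)%:E * lip_a f x).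
Proof.
move=> hf hg fM g0.
have ff := LIP_loc_lty hf (x := x) I; have gf := LIP_loc_lty hg (x := x) I.
have fM_le : lip_a (fun y => M - `|f y|)%R x <= lip_a f x.
  apply: (@lip_a_comp1 _ _ _ f x (fun a => M - `|a|)%R) => a b.
  exact: sub_norm_lip.
have fMf : lip_a (fun y => M - `|f y|)%R x < +oo by exact: le_lt_trans fM_le ff.
apply: le_trans (leeD (lip_a_mul ff gf) (lip_a_mul fMf gf)) _.
move: fM_le; rewrite (lip_a_fineK ff) (lip_a_fineK gf) (lip_a_fineK fMf) lee_fin => fM_le.
rewrite (ger0_norm g0) (ger0_norm (x := (M - `|f x|)%R)) ?subr_ge0//.
rewrite -!EFinM -!EFinD lee_fin.
have := ler_wpM2l g0 fM_le.
rewrite mulrBl; lra.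
Qed.

(** The bounds [M] and [L] on [f] and its slope serve only to make error terms small; neither enters
    the estimate, which is what later permits approximants without a common bound. *)
Lemma variation_le_mul_indic f (M L : R) : LIP_loc setT f -> (0 < M)%R -> (0 <= L)%R ->
  (forall x, `|f x| <= M)%R -> (forall x, lip_a f x <= L%:E) ->
  variation_le m (fun x => f x * \1_K x)%R
    (2 * fine (\int[m]_(x in K) lip_a f x) + lam * fine (\int[m]_(x in K) `|f x|%:E)).
Proof.
move=> hf M0 L0 fM fL.
have mf := measurable_LIP_locT hX hf.
have mnf : measurable_fun setT (fun x => `|f x|%R) by exact: measurableT_comp.
have m1K : measurable_fun setT (\1_K : X -> R) by exact: measurable_indic.
set i1 := fine _; set i2 := fine _.
have i1E : \int[m]_(x in K) lip_a f x = i1%:E.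
  rewrite /i1 fineK//.
  under eq_integral => x _ do rewrite (lip_a_fineK (LIP_loc_lty hf (x := x) I)).
  apply: (@integral_compact_fin _ L).
    apply: measurableT_comp => //; exact: measurable_lip_a.
  move=> x Kx; rewrite -!lee_fin -lip_a_fineK ?fL ?lip_a_ge0//.
  exact: (LIP_loc_lty hf).
have i2E : \int[m]_(x in K) `|f x|%:E = i2%:E.
  rewrite /i2 fineK//; apply: (@integral_compact_fin _ M); first exact: measurable_funTS.
  by move=> x Kx; rewrite normr_ge0 fM.
pose u x := ((M - `|f x|) * \1_K x)%R.
have mu : measurable_fun setT u.
  by apply: measurable_funM => //; apply: measurable_funB.
have hnf : LIP_loc setT (fun x => `|f x|%R).
  apply: (@LIP_loc_comp _ _ _ setT f (@Num.norm _ _) 1%R ltr01 openT) hf => a b.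
  by rewrite mul1r; exact: ler_dist_dist.
(* Otherwise functions arbitrarily close to [u] would have energy below [M * c - lam * i2 - e]. That
   number would then be an admissible bound for [u], against [minimal_energy_lower_bound]. *)
have lower e : (0 < e)%R -> exists2 dlt : R, (0 < dlt)%R & forall q, LIP_loc setT q ->
    L1dist m q u <= dlt%:E -> (M * c - lam * i2 - e)%:E <= \int[m]_x lip_a q x.
  move=> e0; apply: contrapT => H.
  suff : (M * c)%:E <= (M * c - lam * i2 - e)%:E + lam%:E * \int[m]_(x in K) (M - u x)%:E.
    have -> : \int[m]_(x in K) (M - u x)%:E = i2%:E.
      rewrite -i2E; apply: eq_integral => x xK; congr (_%:E).
      by rewrite /u indicE xK mulr1; lra.
    by rewrite -EFinM -EFinD lee_fin; lra.
  apply: minimal_energy_lower_bound => //.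
  - by move=> x nKx; rewrite /u indicE memNset// mulr0.
  - move=> x Kx; rewrite /u indicE mem_set// mulr1 subr_ge0 fM /=.
    by rewrite gerBl.
  (* For [t > 0] the superlevel set is the part of [K] where [|f| <= M - t], closed in a compact
     set. *)
  - move=> t t0; rewrite (_ : [set x | _] = K `&` ~` [set x | (M - t < `|f x|)%R]).
      apply: compact_closedI => //; apply: open_closedC; exact: open_LIP_loc_gt.
    apply/seteqP; split=> x /=; rewrite /u indicE.
      have [/set_mem Kx|] := boolP (x \in K); last by rewrite mulr0; lra.
      by rewrite mulr1 => H1; split=> //; apply/negP; rewrite -leNgt; lra.
    by move=> [Kx /negP]; rewrite -leNgt mem_set// mulr1; lra.
  move=> e' e'0; apply: contrapT => nH; apply: H; exists e' => // q hq qu.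
  rewrite leNgt; apply/negP => lt; apply: nH; exists q; split => //.
  by apply: (le_trans (ltW lt)); rewrite lee_fin; lra.
move=> e e0; have e4 : (0 < e / 4)%R by rewrite divr_gt0.
have [dlt dlt0 Hd] := lower _ e4.
(* The first term keeps the product with [M - |f|] within [dlt] of [u], so that [lower] applies; the
   second keeps the remaining errors [M * e'] and [L * e'] below [e / 4]. *)
pose e' : R := Num.min (dlt / M)%R (e / 4 / (M + L + 1))%R.
have ML0 : (0 < M + L + 1)%R by lra.
have e'0 : (0 < e')%R by rewrite /e' lt_min !divr_gt0.
have Me'd : (M * e' <= dlt)%R.
  by rewrite mulrC -ler_pdivlMr// /e' ge_min lexx.
have MLe : ((M + L + 1) * e' <= e / 4)%R.
  by rewrite mulrC -ler_pdivlMr// /e' ge_min lexx orbT.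
have Le'0 : (0 <= L * e')%R by rewrite mulr_ge0// ltW.
have Me'0 : (0 <= M * e')%R by rewrite mulr_ge0// ltW.
rewrite !mulrDl mul1r in MLe.
have [g0 [hg0 g0K Eg0]] := vK e'0.
(* Truncation to [[0, 1]] increases neither the distance to the indicator nor the energy. *)
pose g := clip \o g0.
have hg : LIP_loc setT g.
  apply: (@LIP_loc_comp _ _ _ setT g0 (@clip R) 1%R ltr01 openT) hg0 => a b.
  by rewrite mul1r; exact: clip_lip.
have g01 x : (0 <= g x <= 1)%R by exact: clip_itv.
have mg := measurable_LIP_locT hX hg.
have gK : L1dist m g \1_K <= e'%:E.
  apply: le_trans g0K; apply: ge0_le_integral => //.
  - exact: measurable_abs_sub.
  - by apply: measurable_abs_sub => //; exact: (measurable_LIP_locT hX).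
  - move=> x _; rewrite lee_fin.
    rewrite [X in (`|_ - X| <= _)%R](_ : _ = clip (\1_K x)); last first.
      by rewrite indicE; case: (x \in K); [rewrite clip1|rewrite clip0].
    exact: clip_lip.
have Eg : \int[m]_x lip_a g x <= (c + e')%:E.
  apply: le_trans Eg0; apply: ge0_le_integral => //; do ?exact: measurable_lip_a.
  - by move=> x _; exact: lip_a_ge0.
  - by move=> x _; apply: lip_a_comp1 => a b; exact: clip_lip.
pose p x := (f x * g x)%R; pose q x := ((M - `|f x|) * g x)%R.
have LIP_mul a b : LIP_loc setT a -> LIP_loc setT b -> LIP_loc setT (fun x => a x * b x)%R.
  move=> ha hb; apply: LIP_locP => [|x _]; first exact: openT.
  have af := LIP_loc_lty ha (x := x) I; have bf := LIP_loc_lty hb (x := x) I.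
  apply: le_lt_trans (lip_a_mul af bf) _.
  by rewrite (lip_a_fineK af) (lip_a_fineK bf) -!EFinM -EFinD ltry.
have hp : LIP_loc setT p by exact: LIP_mul.
have hq : LIP_loc setT q.
  apply: LIP_mul => //.
  apply: (@LIP_loc_comp _ _ _ setT f (fun a => M - `|a|)%R 1%R ltr01 openT) hf => a b.
  by rewrite mul1r; exact: sub_norm_lip.
have dist_mul (a : X -> R) : measurable_fun setT a -> (forall x, `|a x| <= M)%R ->
    L1dist m (fun x => a x * g x)%R (fun x => a x * \1_K x)%R <= (M * e')%:E.
  move=> ma aM; apply: (@le_trans _ _ (\int[m]_x (M%:E * `|g x - \1_K x|%:E))).
    apply: ge0_le_integral => //.
    - by apply: measurable_abs_sub; exact: measurable_funM.
    - by apply: measurable_funeM; exact: measurable_abs_sub.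
    - by move=> x _; rewrite -EFinM lee_fin -mulrBr normrM ler_wpM2r.
  rewrite ge0_integralZl//; last 2 first.
  - exact: measurable_abs_sub.
  - by rewrite lee_fin ltW.
  by rewrite EFinM lee_wpmul2l// lee_fin ltW.
exists p; split => //.
  by apply: le_trans (dist_mul f mf fM) _; rewrite lee_fin; lra.
have Eq : (M * c - lam * i2 - e / 4)%:E <= \int[m]_x lip_a q x.
  apply: Hd => //; apply: (le_trans (dist_mul (fun x => M - `|f x|)%R _ _)); last by rewrite lee_fin.
    exact: measurable_funB.
  move=> x; rewrite ger0_norm ?subr_ge0//; by rewrite gerBl.
have mlf : measurable_fun setT (lip_a f : X -> \bar R) by exact: measurable_lip_a.
have mlg : measurable_fun setT (lip_a g : X -> \bar R) by exact: measurable_lip_a.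
have mgf : measurable_fun setT (fun x => (g x)%:E * lip_a f x).
  by apply: emeasurable_funM => //; exact/measurable_EFinP.
have gf0 x : 0 <= (g x)%:E * lip_a f x.
  by rewrite mule_ge0 ?lip_a_ge0// lee_fin; have /andP[] := g01 x.
(* Since [g] is at most the indicator plus [|g - \1_K|], replacing [g] by the indicator costs at
   most [L * e']. *)
have Igf : \int[m]_x ((g x)%:E * lip_a f x) <= (i1 + L * e')%:E.
  apply: (@le_trans _ _ (\int[m]_x ((lip_a f \_ K) x + L%:E * `|g x - \1_K x|%:E))).
    apply: ge0_le_integral => //.
    - apply: emeasurable_funD; first by apply/(measurable_restrictT _ _).1 => //; exact: measurable_funTS.
      by apply: measurable_funeM; exact: measurable_abs_sub.
    - move=> x _; have := fL x; have := lip_a_ge0 f x.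
      have := lip_a_fineK (LIP_loc_lty hf (x := x) I).
      move: (fine _) => l lE; rewrite lE !lee_fin => l0 lL.
      have /andP[gx0 gx1] := g01 x.
      rewrite patchE indicE; case: (x \in K); rewrite ?lE -!EFinM ?add0e -?EFinD lee_fin /=.
        have : (g x * l <= 1 * l)%R by rewrite ler_wpM2r.
        have : (0 <= L * `|g x - 1|)%R by rewrite mulr_ge0.
        by rewrite /=; lra.
      by rewrite subr0 ger0_norm// mulrC ler_wpM2r.
  have A0 x : setT x -> 0 <= (lip_a f \_ K) x.
    by move=> _; apply: erestrict_ge0 => y _; exact: lip_a_ge0.
  have mA : measurable_fun setT (lip_a f \_ K).
    by apply/(measurable_restrictT _ _).1 => //; exact: measurable_funTS.
  have B0 x : setT x -> 0 <= `|g x - \1_K x|%:E by rewrite lee_fin.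
  have mB : measurable_fun setT (fun x => `|g x - \1_K x|%:E) by exact: measurable_abs_sub.
  have LB0 x : setT x -> 0 <= L%:E * `|g x - \1_K x|%:E.
    by move=> _; rewrite mule_ge0// lee_fin.
  have L0' : 0 <= L%:E by rewrite lee_fin.
  rewrite (ge0_integralD m measurableT A0 mA LB0 (measurable_funeM _ mB)).
  rewrite -integral_mkcond i1E (ge0_integralZl m measurableT mB B0 L0').
  by rewrite EFinD leeD// EFinM lee_wpmul2l// lee_fin.
have Epq : \int[m]_x lip_a p x + \int[m]_x lip_a q x <= (M * (c + e') + 2 * (i1 + L * e'))%:E.
  rewrite -ge0_integralD//; do ?[exact: measurable_lip_a | by move=> x _; exact: lip_a_ge0].
  apply: (@le_trans _ _ (\int[m]_x (M%:E * lip_a g x + 2%:E * ((g x)%:E * lip_a f x)))).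
    apply: ge0_le_integral => //.
    - by move=> x _; rewrite adde_ge0 ?lip_a_ge0.
    - by apply: emeasurable_funD; exact: measurable_lip_a.
    - by apply: emeasurable_funD; exact: measurable_funeM.
    - by move=> x _; apply: lip_a_mul_complement => //; have /andP[] := g01 x.
  have M0' : 0 <= M%:E by rewrite lee_fin ltW.
  have lg0 x : setT x -> 0 <= lip_a g x by move=> _; exact: lip_a_ge0.
  have Mlg0 x : setT x -> 0 <= M%:E * lip_a g x by move=> ?; rewrite mule_ge0// lg0.
  have gf0' x : setT x -> 0 <= (g x)%:E * lip_a f x by [].
  have two0 : 0 <= 2%:E :> \bar R by rewrite lee_fin.
  have gf20 x : setT x -> 0 <= 2%:E * ((g x)%:E * lip_a f x) by move=> ?; rewrite mule_ge0.
  rewrite (ge0_integralD m measurableT Mlg0 (measurable_funeM _ mlg) gf20 (measurable_funeM _ mgf)).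
  rewrite (ge0_integralZl m measurableT mlg lg0 M0') (ge0_integralZl m measurableT mgf gf0' two0).
  apply: (@le_trans _ _ (M%:E * (c + e')%:E + 2%:E * (i1 + L * e')%:E)); last first.
    by rewrite -!EFinM -EFinD.
  by apply: leeD; exact: lee_wpmul2l.
(* Subtracting the lower bound for the energy of [q] cancels [M * c] and leaves [lam * i2]. *)
have : \int[m]_x lip_a p x + (M * c - lam * i2 - e / 4)%:E <= (M * (c + e') + 2 * (i1 + L * e'))%:E.
  by apply: le_trans Epq; rewrite leeD2l.
rewrite -leeBrDr//= -EFinB => /le_trans; apply; rewrite lee_fin !mulrDr; lra.
Qed.

End minimal_set.

(** * Compact sets of finite energy *)

Section truncated_distance.
Context {d : measure_display} {R : realType} {X : completeMetricMeasurableType d R}.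
Implicit Types (f g : X -> R) (x y : X) (A : set X) (r s : R).

(* The cap at 1 makes the infimum meaningful for the empty set. *)
Definition tdist A x : R :=
  inf [set r | r = 1 \/ exists2 y, A y & r = mdist x y].

Let tdist_has_inf A x : has_inf [set r | r = 1 \/ exists2 y, A y & r = mdist x y].
Proof.
split; first by exists 1; left.
by exists 0 => _ [->|[y _ ->]]; [exact: ler01|exact: mdist_ge0].
Qed.

Lemma tdist_ge0 A x : 0 <= tdist A x.
Proof.
apply: lb_le_inf; first by have [] := tdist_has_inf A x.
by move=> _ [->|[y _ ->]]; [exact: ler01|exact: mdist_ge0].
Qed.

Lemma tdist_le A x y : A y -> tdist A x <= mdist x y.
Proof. by move=> Ay; apply: ge_inf; [have [] := tdist_has_inf A x|right; exists y]. Qed.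

Lemma tdist_lt A x r : r <= 1 -> tdist A x < r -> exists2 y, A y & mdist x y < r.
Proof.
move=> r1 /(inf_lt (tdist_has_inf A x).1)[_ [->|[y Ay ->]] yr]; last by exists y.
by have := lt_le_trans yr r1; rewrite ltxx.
Qed.

Lemma tdist_eq0 A x : A x -> tdist A x = 0.
Proof.
by move=> Ax; apply/eqP; rewrite eq_le tdist_ge0 andbT -(mdistxx x) tdist_le.
Qed.

Lemma tdist_ge A x r : r <= 1 -> (forall y, A y -> r <= mdist x y) -> r <= tdist A x.
Proof.
move=> r1 H; apply: lb_le_inf; first by have [] := tdist_has_inf A x.
by move=> _ [->//|[y Ay ->]]; exact: H.
Qed.

Lemma tdist_anti A B x : A `<=` B -> tdist B x <= tdist A x.
Proof.
move=> AB; apply: lb_le_inf; first by have [] := tdist_has_inf A x.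
move=> r Hr; apply: ge_inf; first by have [] := tdist_has_inf B x.
by case: Hr => [->|[y Ay ->]]; [left|right; exists y => //; exact: AB].
Qed.

Lemma tdist_lip A x y : `|tdist A x - tdist A y| <= mdist x y.
Proof.
have H z w : tdist A z - tdist A w <= mdist z w.
  rewrite lerBlDr -lerBlDl; apply: lb_le_inf; first by have [] := tdist_has_inf A w.
  move=> _ [->|[v Av ->]].
    have : tdist A z <= 1 by apply: ge_inf; [have [] := tdist_has_inf A z|left].
    have := mdist_ge0 z w; lra.
  by have := tdist_le z Av; have := metric_triangle z w v; lra.
have := H x y; have := H y x; rewrite (metric_sym y x) ler_norml => ? ?.
by apply/andP; split; lra.
Qed.

Lemma lipschitz_lip_a f k x : 0 <= k -> (forall y z, `|f y - f z| <= k * mdist y z) ->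
  (lip_a f x <= k%:E)%E.
Proof. by move=> k0 H; apply: (@lip_a_lbound _ _ _ _ _ _ 1). Qed.

Lemma lipschitz_LIP_loc f k : 0 <= k -> (forall y z, `|f y - f z| <= k * mdist y z) ->
  LIP_loc setT f.
Proof.
move=> k0 H; apply: LIP_locP => [|x _]; first exact: openT.
by apply: le_lt_trans (lipschitz_lip_a x k0 H) (ltry _).
Qed.

(** Equal to 0 where [tdist A <= s] and to 1 where [tdist A >= 2 * s]. Vanishing on a whole
    neighbourhood of [A], and not only on [A], makes the slope vanish there too. *)
Definition ramp A s x : R := clip (tdist A x / s - 1).

Lemma ramp_lip A s y z : 0 < s -> `|ramp A s y - ramp A s z| <= s^-1 * mdist y z.
Proof.
move=> s0; apply: le_trans (clip_lip _ _) _.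
rewrite opprB addrA subrK -mulrBl normrM (ger0_norm (x := s^-1)); last by rewrite invr_ge0 ltW.
by rewrite mulrC ler_pM2l ?invr_gt0// tdist_lip.
Qed.

Lemma LIP_loc_ramp A s : 0 < s -> LIP_loc setT (ramp A s).
Proof.
move=> s0; apply: (@lipschitz_LIP_loc _ s^-1) => [|y z]; first by rewrite invr_ge0 ltW.
exact: ramp_lip.
Qed.

Lemma ramp_itv A s x : 0 <= ramp A s x <= 1.
Proof. exact: clip_itv. Qed.

Lemma ramp0 A s x : 0 < s -> tdist A x <= s -> ramp A s x = 0.
Proof. by move=> s0 xs; rewrite /ramp clip0// subr_le0 ler_pdivrMr// mul1r. Qed.

Lemma ramp1 A s x : 0 < s -> 2 * s <= tdist A x -> ramp A s x = 1.
Proof.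
move=> s0 xs; rewrite /ramp clip1// lerBrDr ler_pdivlMr//; lra.
Qed.

Lemma ramp_lt1 A s x : 0 < s -> ramp A s x < 1 -> tdist A x < 2 * s.
Proof. by move=> s0; apply: contraPT; rewrite -leNgt => /(ramp1 s0) ->; rewrite ltxx. Qed.

Lemma open_tdist_lt A s : open [set x | tdist A x < s].
Proof.
apply: openP_ball => x /= xs; exists (s - tdist A x); first by rewrite subr_gt0.
move=> y; rewrite ballEmdist /= => xy; have := tdist_lip A x y; rewrite ler_norml; lra.
Qed.

Lemma open_tdist_gt A s : open [set x | s < tdist A x].
Proof.
apply: openP_ball => x /= xs; exists (tdist A x - s); first by rewrite subr_gt0.
move=> y; rewrite ballEmdist /= => xy; have := tdist_lip A x y; rewrite ler_norml; lra.
Qed.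

Lemma lip_a_ramp A s x : 0 < s ->
  (lip_a (ramp A s) x <= (s^-1 * \1_[set x | (s <= tdist A x)%R] x)%:E)%E.
Proof.
move=> s0; have [xs|xs] := leP s (tdist A x).
  rewrite indicE mem_set// mulr1; apply: lipschitz_lip_a => [|y z].
    by rewrite invr_ge0 ltW.
  exact: ramp_lip.
rewrite indicE memNset ?mulr0; last by rewrite /= leNgt xs.
have [r r0 rs] := open_ballP (@open_tdist_lt A s) xs.
rewrite (lip_a_cst0 (a := 0) r0)// => y /rs /= ys; by rewrite ramp0// ltW.
Qed.

(** An ultrafilter containing [A] contains a ball of every finite net: otherwise it would contain
    the points of [A] far from all centres, an empty set. It is therefore Cauchy and converges by
    completeness. *)
Lemma totally_bounded_compact A : closed A ->
  (forall e : R, 0 < e -> exists (x : nat -> X) k, forall y, A y ->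
     exists2 i, (i < k)%N & mdist y (x i) < e) -> compact A.
Proof.
move=> cA tb; rewrite compact_ultra => F FU FA.
have FF : ProperFilter F by exact: ultra_proper.
have Fc : cauchy F.
  apply/cauchyP => e e0; have [x [k Hk]] := tb e e0.
  apply: contrapT => /forallNP nF.
  suff H j : (j <= k)%N -> F [set y | A y /\ forall i, (i < j)%N -> e <= mdist y (x i)].
    apply: (@filter_not_empty _ F); rewrite 
      (_ : set0 = [set y | A y /\ forall i, (i < k)%N -> e <= mdist y (x i)]).
      exact: H.
    apply/esym; rewrite -subset0 => y [/Hk[i ik]] yi /(_ i ik); lra.
  elim: j => [|j IH] jk; first by apply: filterS FA => y Ay; split.
  have [Fb|Fb] := in_ultra_setVsetC (ball (x j) e) FU; first by have := nF _ Fb.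
  apply: filterS (filterI (IH (ltnW jk)) Fb) => y [[Ay Hy] yj]; split=> // i.
  rewrite ltnS leq_eqVlt => /orP[/eqP ->|]; last exact: Hy.
  by move: yj; rewrite ballEmdist /= => /negP; rewrite -leNgt metric_sym.
have /cvg_ex[l Fl] := @cauchy_cvg X F FF Fc.
exists l; split => //; apply: (cA l) => B Bl.
apply: (@filter_ex _ F); apply: filterI => //; exact: Fl.
Qed.

End truncated_distance.

(** * Nearly exhausting a bounded open set by a compact set *)

Section compact_start.
Context {d : measure_display} {R : realType} {X : completeMetricMeasurableType d R}.
Variable m : {measure set X -> \bar R}.
Hypothesis hX : metric_measure_space m.
Variable Omega : set X.
Hypotheses (Oopen : open Omega) (Obounded : metric_bounded Omega).
Implicit Types (f g h u : X -> R) (c e t s : R).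
Local Open Scope ereal_scope.

Let hB : borel_space X. Proof. by have [] := hX. Qed.
Let mO : measurable Omega. Proof. exact: open_measurable_borel. Qed.
Let Ofin : m Omega < +oo. Proof. by have [_ _] := hX; apply. Qed.

Lemma nonincreasing_measure_small (F : nat -> set X) e : (0 < e)%R ->
  (forall n, measurable (F n)) -> m (F 0%N) < +oo -> \bigcap_n F n = set0 ->
  (forall i j, (i <= j)%N -> F j `<=` F i) -> exists n, m (F n) <= e%:E.
Proof.
move=> e0 mF F0 FI dF.
have H : (m \o F) @ \oo --> 0.
  rewrite -[0](measure0 m) -FI; apply: nonincreasing_cvg_mu => //.
    by rewrite FI.
  by move=> i j ij; apply/subsetPset; exact: dF.
have [N _ HN] : \forall n \near \oo, m (F n) < e%:E.
  move: H => /(_ [set y | y < e%:E]); apply.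
  by apply: open_nbhs_nbhs; split; [exact: open_ereal_lt_ereal|rewrite /= lte_fin].
by exists N; apply: ltW; exact: HN (leqnn _).
Qed.

Lemma thin_boundary_layer e : (0 < e)%R -> exists2 s, (0 < s)%R &
  m (Omega `&` [set x | (tdist (~` Omega) x < 2 * s)%R]) <= e%:E.
Proof.
move=> e0; pose dl (n : nat) : R := (n.+1%:R^-1)%R.
have dl0 n : (0 < dl n)%R by rewrite invr_gt0.
pose F n := Omega `&` [set x | (tdist (~` Omega) x < dl n)%R].
have mF n : measurable (F n).
  by apply: measurableI => //; apply: open_measurable_borel => //; exact: open_tdist_lt.
have [n Hn] : exists n, m (F n) <= e%:E.
  apply: nonincreasing_measure_small => //.
  - apply: le_lt_trans Ofin; apply: le_measure; [rewrite inE; exact: mF|by rewrite inE|exact: subIsetl].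
  - rewrite -subset0 => x Fx; have [Ox _] := Fx 0%N I.
    have [r r0 rO] := open_ballP Oopen Ox.
    pose r' := Num.min r 1%R; have r'0 : (0 < r')%R by rewrite lt_min r0 ltr01.
    have : (r' <= tdist (~` Omega) x)%R.
      apply: tdist_ge; first by rewrite /r' ge_min lexx orbT.
      move=> y nOy; rewrite leNgt; apply/negP => xy; apply: nOy; apply: rO.
      by rewrite ballEmdist /= (lt_le_trans xy)// /r' ge_min lexx.
    have [N _ HN] := near_infty_natSinv_lt (PosNum r'0).
    have [_ /=] := Fx N I; have := HN N (leqnn _) => /=.
    by rewrite -/(dl N); lra.
  - move=> i j ij x [Ox /= xj]; split=> //=; apply: lt_le_trans xj _.
    by rewrite /dl lef_pV2 ?posrE// ler_nat ltnS.
exists (dl n / 2)%R; first by rewrite divr_gt0.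
by rewrite mulrC divfK.
Qed.

Lemma dense_sequence : exists x : nat -> X, forall y r, (0 < r)%R ->
  exists n, (mdist y (x n) < r)%R.
Proof.
have [_ [D cD dD] _] := hX.
have [f finj] : exists f : X -> nat, {in D &, injective f} by apply/countable_injP.
(* Indices outside the range of [f] yield the default [point], possibly outside [D]; this does no
   harm to density. *)
exists (fun n => xget (point : X) [set y | D y /\ f y = n]) => y r r0.
have [z [yz Dz]] : ball y r `&` D !=set0.
  apply: dD; first by exists y; rewrite ballEmdist /= mdistxx.
  by apply: openP_ball => z /ball_in[t t0 tr]; exists t.
exists (f z); case: xgetP => [w _ [Dw fw]|/(_ z)[]//].
have -> : w = z by apply: finj; rewrite ?inE.
by move: yz; rewrite ballEmdist.
Qed.

(** Every point is within [s] of some [x n], so the parts of [Omega] missed by the first [k] balls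
    decrease to the empty set. *)
Lemma finite_net_measure (x : nat -> X) s e :
  (forall y r, (0 < r)%R -> exists n, (mdist y (x n) < r)%R) -> (0 < s)%R -> (0 < e)%R ->
  exists k, m (Omega `&` [set y | (s <= tdist (x @` `I_k) y)%R]) <= e%:E.
Proof.
move=> xd s0 e0.
have mF k : measurable (Omega `&` [set y | (s <= tdist (x @` `I_k) y)%R]).
  apply: measurableI => //; rewrite (_ : [set y | _] = ~` [set y | (tdist (x @` `I_k) y < s)%R]).
    by apply: measurableC; apply: open_measurable_borel => //; exact: open_tdist_lt.
  by apply/seteqP; split=> y /=; rewrite leNgt => /negP.
apply: (@nonincreasing_measure_small (fun k => Omega `&` [set y | (s <= tdist (x @` `I_k) y)%R])) => //.
- apply: le_lt_trans Ofin; apply: le_measure; [rewrite inE; exact: mF|by rewrite inE|exact: subIsetl].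
- rewrite -subset0 => y Fy; have [n yn] := xd y s s0.
  have [_ /=] := Fy n.+1 I; rewrite leNgt => /negP; apply.
  by apply: le_lt_trans yn; apply: tdist_le; exists n => //=.
- move=> i j ij y [Oy /= yj]; split=> //=; apply: (le_trans yj).
  by apply: tdist_anti => _ [n /= ni <-]; exists n => //=; exact: leq_trans ij.
Qed.

Lemma LIP_loc_min f g : LIP_loc setT f -> LIP_loc setT g ->
  LIP_loc setT (fun y => Num.min (f y) (g y)).
Proof.
move=> hf hg; apply: LIP_locP => [|x _]; first exact: openT.
apply: le_lt_trans (lip_a_min _ _ _) _; apply: lte_add_pinfty.
  exact: (LIP_loc_lty hf).
exact: (LIP_loc_lty hg).
Qed.

(* The limit of w vanishes off a totally bounded set, though no single w n does:
   compact sets may have empty interior. *)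
Lemma tight_cutoffs e : (0 < e)%R -> exists (w : nat -> X -> R) (C : R),
  [/\ forall n, LIP_loc setT (w n),
      forall n x, (0 <= w n x <= 1)%R /\ (w n.+1 x <= w n x)%R,
      forall n x, ~ Omega x -> w n x = 0%R,
      forall n, \int[m]_x lip_a (w n) x <= C%:E &
      (forall r, (0 < r)%R -> exists (x : nat -> X) k n, forall y, (0 < w n y)%R ->
        exists2 i, (i < k)%N & (mdist y (x i) < r)%R) /\
      exists B : set X, [/\ measurable B, m B <= e%:E &
        forall x, Omega x -> ~ B x -> forall n, w n x = 1%R]].
Proof.
move=> e0; pose del := (e / 2)%R; have del0 : (0 < del)%R by rewrite divr_gt0.
have [s s0 Hs] := thin_boundary_layer del0.
have [x xd] := dense_sequence.
(* At most [1/4], so that [2 * sj j] stays below the cap of [tdist]. *)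
pose sj (j : nat) : R := (j.+4%:R^-1)%R.
have sj0 j : (0 < sj j)%R by rewrite invr_gt0.
pose b (j : nat) : R := (del / (2 ^ j.+1)%:R)%R.
have b0 j : (0 < b j)%R by rewrite divr_gt0// ltr0n expn_gt0.
(* The set missed by net [j] gets measure at most [sj j * b j]: a slope [1 / sj j] on it then costs
   energy at most [b j], and these costs sum to at most [del]. *)
have sb0 j : (0 < sj j * b j)%R by rewrite mulr_gt0.
have [k Hk] := choice (fun j => finite_net_measure xd (sj0 j) (sb0 j)).
pose A j := x @` `I_(k j).
pose B j := [set y | (sj j <= tdist (A j) y)%R].
have mB j : measurable (B j).
  rewrite /B (_ : [set y | _] = ~` [set y | (tdist (A j) y < sj j)%R]).
    by apply: measurableC; apply: open_measurable_borel => //; exact: open_tdist_lt.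
  by apply/seteqP; split=> y /=; rewrite leNgt => /negP.
pose psi j y := (1 - ramp (A j) (sj j) y)%R.
pose w := fix w (n : nat) : X -> R :=
  if n is j.+1 then fun y => Num.min (w j y) (psi j y) else ramp (~` Omega) s.
have psi_lip j y : lip_a (psi j) y <= ((sj j)^-1 * \1_(B j) y)%:E.
  apply: le_trans (lip_a_ramp _ _ (sj0 j)).
  apply: (@lip_a_comp1 _ _ _ (ramp (A j) (sj j)) y (fun a => 1 - a)%R) => a b'.
  have -> : (1 - a - (1 - b') = b' - a)%R by lra.
  by rewrite distrC.
have hpsi j : LIP_loc setT (psi j).
  apply: LIP_locP => [|y _]; first exact: openT.
  exact: le_lt_trans (psi_lip j y) (ltry _).
have psi01 j y : (0 <= psi j y <= 1)%R.
  have /andP[? ?] := ramp_itv (A j) (sj j) y; rewrite /psi; apply/andP; split; lra.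
have hw n : LIP_loc setT (w n).
  by elim: n => [|n IH] /=; [exact: LIP_loc_ramp|exact: LIP_loc_min].
have w01 n y : (0 <= w n y <= 1)%R.
  elim: n => [|n /andP[? ?]] /=; first exact: ramp_itv.
  by have /andP[? ?] := psi01 n y; rewrite le_min ge_min; apply/andP; split; [apply/andP|apply/orP; left].
have wdec n y : (w n.+1 y <= w n y)%R by rewrite /= ge_min lexx.
have w_ramp n y : (w n y <= ramp (~` Omega) s y)%R.
  by elim: n => [//|n IH]; exact: le_trans (wdec n y) IH.
have w_near n y : (tdist (~` Omega) y < s)%R -> w n y = 0%R.
  move=> ys; apply/eqP; rewrite eq_le; have /andP[-> _] := w01 n y.
  by rewrite (le_trans (w_ramp n y))// ramp0// ltW.
have off n y : ~ Omega y -> lip_a (w n) y = 0.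
  move=> nOy; have ys : (tdist (~` Omega) y < s)%R by rewrite tdist_eq0.
  have [r r0 rs] := open_ballP (@open_tdist_lt _ _ _ (~` Omega) s) ys.
  by apply: (lip_a_cst0 (a := 0%R) r0) => z /rs; exact: w_near.
have bsum n : \sum_(0 <= j < n) (b j)%:E <= del%:E.
  apply: le_trans (epsilon_trick0 xpredT (ltW del0)).
  by apply: nneseries_lim_ge => j _ _; rewrite lee_fin ltW.
pose C0 := (s^-1 * fine (m Omega))%R.
have mlip f : measurable_fun Omega (lip_a f : X -> \bar R) by exact: measurable_lip_a.
have Iw n : \int[m]_(y in Omega) lip_a (w n) y <= C0%:E + \sum_(0 <= j < n) (b j)%:E.
  elim: n => [|n IH].
    rewrite big_geq// adde0; apply: (@le_trans _ _ (\int[m]_(y in Omega) s^-1%:E)).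
      apply: ge0_le_integral => //; first by move=> y _; exact: lip_a_ge0.
      by move=> y _; apply: lipschitz_lip_a => [|z z']; [rewrite invr_ge0 ltW|exact: ramp_lip].
    rewrite integral_cst// /C0 EFinM fineK// ge0_fin_numE//.
  rewrite big_nat_recr//= addeA.
  apply: (@le_trans _ _ (\int[m]_(y in Omega) (lip_a (w n) y + lip_a (psi n) y))).
    apply: ge0_le_integral => //.
    - by move=> y _; exact: lip_a_ge0.
    - exact: emeasurable_funD.
    - by move=> y _; exact: lip_a_min.
  rewrite ge0_integralD//; do ?by move=> y _; exact: lip_a_ge0.
  apply: leeD => //.
  have mind : measurable_fun Omega (fun y => (\1_(B n) y)%:E : \bar R).
    by apply/measurable_EFinP; exact: measurable_indic.
  apply: (@le_trans _ _ (\int[m]_(y in Omega) ((sj n)^-1%:E * (\1_(B n) y)%:E))).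
    apply: ge0_le_integral => [//|y _|//||y _].
    - exact: lip_a_ge0.
    - exact: measurable_funeM.
    - by rewrite -EFinM; exact: psi_lip.
  have ind0 y : Omega y -> 0 <= (\1_(B n) y)%:E :> \bar R by rewrite lee_fin.
  have sj0' : 0 <= ((sj n)^-1)%:E by rewrite lee_fin invr_ge0 ltW.
  rewrite (ge0_integralZl m mO mind ind0 sj0') integral_indic// setIC.
  by rewrite lee_pdivrMl// -EFinM; exact: Hk.
exists w, (C0 + del)%R; split => //.
- by move=> n y nOy; apply: w_near; rewrite tdist_eq0.
- move=> n; apply: (@le_trans _ _ (\int[m]_(y in Omega) lip_a (w n) y)).
    rewrite [leRHS]integral_mkcond le_eqVlt; apply/orP; left; apply/eqP.
    apply: eq_integral => y _; rewrite patchE; case: ifPn => // /negP nOy.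
    by apply: off => Oy; apply: nOy; rewrite inE.
  by apply: le_trans (Iw n) _; rewrite EFinD leeD2l.
split.
  move=> r r0; have r2 : (0 < r / 2)%R by rewrite divr_gt0.
  have [N _ HN] := near_infty_natSinv_lt (PosNum r2).
  (* Stage [N.+2] is the first whose minimum includes [psi N.+1]; positivity there forces the point
     to be near net [N.+1]. *)
  exists x, (k N.+1), N.+2 => y wy.
  have : (ramp (A N.+1) (sj N.+1) y < 1)%R.
    by have : (w N.+2 y <= psi N.+1 y)%R; [rewrite [w _]/= ge_min lexx orbT|rewrite /psi; lra].
  move=> /(ramp_lt1 (sj0 _)) yA.
  have sjN : (2 * sj N.+1 <= r)%R.
    rewrite mulrC -ler_pdivlMr//; apply: le_trans (ltW (HN N (leqnn _))).
    by rewrite /sj /= lef_pV2 ?posrE// ler_nat; do 4! apply: leqW.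
  have sj1 : (2 * sj N.+1 <= 1)%R.
    have : (sj N.+1 <= 2^-1)%R by rewrite /sj lef_pV2 ?posrE// ler_nat.
    lra.
  have [_ [i /= ik <-] yi] := tdist_lt sj1 yA.
  by exists i => //; exact: lt_le_trans yi sjN.
pose E0 := Omega `&` [set y | (tdist (~` Omega) y < 2 * s)%R].
have mE0 : measurable E0.
  by apply: measurableI => //; apply: open_measurable_borel => //; exact: open_tdist_lt.
(* Outside the boundary layer and all missed sets, every function entering the minima equals 1. *)
pose E1 := \bigcup_j (Omega `&` B j).
have mOB j : measurable (Omega `&` B j) by exact: measurableI.
have mE1 : measurable E1 by exact: bigcup_measurable.
exists (E0 `|` E1); split.
- exact: measurableU.
- apply: le_trans (measureU2 _ _ _) _ => //.
  rewrite (_ : e = del + del)%R; last by rewrite /del; lra.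
  rewrite EFinD; apply: leeD => //.
  apply: (@le_trans _ _ (\sum_(j <oo) m (Omega `&` B j))).
    exact: measure_sigma_subadditive.
  apply: le_trans (epsilon_trick0 xpredT (ltW del0)).
  apply: lee_nneseries => // j _; apply: le_trans (Hk j) _.
  rewrite lee_fin ger_pMl// /sj invf_le1// ler1n//.
- move=> y Oy nE n.
  have r1 : ramp (~` Omega) s y = 1%R.
    by apply: ramp1 => //; rewrite leNgt; apply/negP => ?; apply: nE; left.
  have p1 j : psi j y = 1%R.
    rewrite /psi ramp0 ?subr0// leNgt; apply/negP => ?; apply: nE; right.
    by exists j => //; split=> //; exact: ltW.
  by elim: n => //= n ->; rewrite p1 minxx.
Qed.

(** The limit [v] of the cutoffs inherits the energy bound by dominated convergence, and coarea
    provides a level of finite energy. That superlevel set is closed, as [v] is an infimum of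
    continuous functions, and totally bounded, as [v <= w n] for all [n]. *)
Lemma compact_approximation e : (0 < e)%R -> exists (K0 : set X) (c0 : R),
  [/\ compact K0, K0 `<=` Omega, m (Omega `\` K0) <= e%:E & variation_le m \1_K0 c0].
Proof.
move=> e0; have [w [C [hw w01 w0 Iw [tb [B [mB mBe Bw]]]]]] := tight_cutoffs e0.
pose v y := inf (range (w ^~ y)).
have lb y : has_lbound (range (w ^~ y)).
  by exists 0%R => _ [n _ <-]; have [/andP[]] := w01 n y.
have hinf y : has_inf (range (w ^~ y)) by split => //; exists (w 0%N y); exists 0%N.
have vle n y : (v y <= w n y)%R by apply: ge_inf => //; exists n.
have wdec y : nonincreasing_seq (w ^~ y).
  by apply/nonincreasing_seqP => n; have [] := w01 n y.
have wv y : w ^~ y @ \oo --> v y by exact: nonincreasing_cvgn.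
have mw n : measurable_fun setT (w n) by exact: (measurable_LIP_locT hX).
have mv : measurable_fun setT v by apply: (@measurable_fun_cvg _ _ _ setT w) => // y _.
have C0 : (0 <= C)%R.
  by rewrite -lee_fin; apply: le_trans (Iw 0%N); apply: integral_ge0 => y _; exact: lip_a_ge0.
have Vv : variation_le m v C.
  apply: (variation_le_lsc hX) => // r r0.
  have [_ H _] : [/\ m.-integrable setT (EFin \o v),
      (fun n => \int[m]_y `|(EFin \o w n) y - (EFin \o v) y|) @ \oo --> 0 &
      (fun n => \int[m]_y (EFin \o w n) y) @ \oo --> \int[m]_y (EFin \o v) y].
    apply: (@dominated_convergence _ _ _ m setT measurableT
      (fun n => EFin \o w n) (EFin \o v) (EFin \o \1_Omega)).
    - by move=> n; exact/measurable_EFinP.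
    - exact/measurable_EFinP.
    - by apply: aeW => y _; apply: cvg_EFin; [exact: nearW|exact: wv].
    - apply/integrableP; split.
        by apply/measurable_EFinP; exact: measurable_indic.
      rewrite (eq_integral (fun y => (\1_Omega y)%:E)); last first.
        by move=> y _; rewrite gee0_abs// lee_fin.
      by rewrite integral_indic// setIT.
    - apply: aeW => y n _; rewrite /= lee_fin indicE.
      have [/andP[a0 a1] _] := w01 n y; rewrite ger0_norm//.
      have [//|nO] := boolP (y \in Omega).
      by rewrite w0// => /mem_set; rewrite (negbTE nO).
  have [N _ HN] : \forall n \near \oo, L1dist m (w n) v < r%:E.
    move: H => /(_ [set y | y < r%:E]); apply.
    by apply: open_nbhs_nbhs; split; [exact: open_ereal_lt_ereal|rewrite /= lte_fin].
  exists (w N), C; split => //; first by apply: ltW; exact: HN (leqnn _).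
    by rewrite lerDl ltW.
  move=> t t0; exists (w N); split => //.
    by rewrite /L1dist; under eq_integral do rewrite subrr normr0; rewrite integral0 lee_fin ltW.
  by apply: le_trans (Iw N) _; rewrite lee_fin lerDl ltW.
have voff y : ~ Omega y -> (v y <= 0)%R by move=> /(w0 0%N) <-.
have [D [mD D0 iD DE]] := variation_le_coarea hX mv mO Ofin voff Vv.
pose I := `](2^-1)%R, 1%R[%classic : set R.
have mI : measurable I by exact: measurable_itv.
(* If [D] were infinite on all of [I], it would exceed [2 * (C + 1)] on an interval of length [1/2],
   and its integral would exceed [C]. *)
have [t It Dt] : exists2 t, I t & D t < +oo.
  apply: contrapT => /forall2NP H.
  suff : (C + 1)%:E <= C%:E by rewrite lee_fin; lra.
  apply: le_trans iD; apply: (@le_trans _ _ (\int[lebesgue_measure]_(t in I) D t)); last first.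
    exact: ge0_subset_integral.
  apply: (@le_trans _ _ (\int[lebesgue_measure]_(t in I) (2 * (C + 1))%:E)).
    rewrite integral_cst//= lebesgue_measure_itv /= lte_fin ifT; last by lra.
    by rewrite -EFinD -EFinM lee_fin; lra.
  apply: ge0_le_integral => //.
  - by move=> t _; rewrite lee_fin mulr_ge0// addr_ge0.
  - exact: measurable_funTS.
  - move=> t It; have [//|/negP] := H t.
    by rewrite -leNgt leye_eq => /eqP ->; exact: leey.
move: It; rewrite /I /= in_itv /= => /andP[t2 t1].
have t0 : (0 < t)%R by lra.
exists [set y | (t <= v y)%R], (fine (D t)); split.
- apply: totally_bounded_compact.
    rewrite (_ : [set y | _] = ~` [set y | (v y < t)%R]).
      apply: open_closedC; apply: openP_ball => y /= yt.
      have [_ [n _ <-] nt] := inf_lt (hinf y).1 yt.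
      have [r r0 rt] := open_ballP (open_LIP_loc_lt t (hw n)) nt.
      by exists r => // z /rt; apply: le_lt_trans; exact: vle.
    by apply/seteqP; split=> y /=; rewrite leNgt => /negP.
  move=> r r0; have [x [k [n H]]] := tb r r0.
  exists x, k => y /= ty; apply: H; have := vle n y; lra.
- by move=> y /= ty; apply: contrapT => /voff; lra.
- apply: le_trans mBe; apply: le_measure; rewrite ?inE//.
    by apply: measurableD => //; exact: measurable_superlevel.
  move=> y [Oy /= ty]; apply: contrapT => nB; apply: ty.
  suff -> : v y = 1%R by exact: ltW.
  have -> : v y = inf [set 1%R]; last by rewrite inf1.
  congr inf; apply/seteqP; split=> [_ [n _ <-]|_ ->] /=; first exact: Bw.
  by exists 0%N => //; exact: Bw.
- by apply: DE => //; rewrite fineK// ge0_fin_numE.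
Qed.

End compact_start.

(** * Localization near a compact set *)

Section localization.
Context {d : measure_display} {R : realType} {X : completeMetricMeasurableType d R}.
Variable m : {measure set X -> \bar R}.
Hypothesis hX : metric_measure_space m.
Implicit Types (f g h u : X -> R) (c e t s : R) (A K : set X).
Local Open Scope ereal_scope.

Let hB : borel_space X. Proof. by have [] := hX. Qed.

Lemma integral_mrestr (D K : set X) (mK : measurable K) (F : X -> \bar R) :
  measurable D -> measurable_fun D F -> (forall x, D x -> 0 <= F x) ->
  \int[mrestr m mK]_(x in D) F x = \int[m]_(x in D `&` K) F x.
Proof.
move=> mD mF F0.
rewrite (ge0_negligible_integral (measurableC mK) mD mF F0); last first.
  by transitivity (m (~` K `&` K)); [|rewrite setICl measure0].
rewrite setDE setCK; apply: eq_measure_integral => B mB BDK.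
have {2}-> : B = B `&` K by rewrite setIidl// => x /BDK[].
by [].
Qed.

Lemma compact_increasing_cover K (V : nat -> set X) : compact K ->
  (forall n, open (V n)) -> (forall i j, (i <= j)%N -> V i `<=` V j) ->
  (forall x, K x -> exists n, V n x) -> exists n, K `<=` V n.
Proof.
rewrite compact_cover => cK oV incV KV.
have [D _ KD] : finite_subset_cover [set: nat] V K.
  by apply: cK => // x /KV[n Vn]; exists n.
exists (\max_(i <- finmap.enum_fset D) i)%N => x /KD[i /= iD Vix].
apply: incV Vix; exact: leq_bigmax_seq.
Qed.

(** [K] lies in the open set [W] where [|f|] and [lip_a f] are below some [n], at positive distance
    from its complement. Multiplying by a ramp that vanishes near the complement of [W] discards the
    arbitrary values of [f] off [A] and changes nothing near [K]. *)
Lemma LIP_loc_extend_compact A K f : open A -> compact K -> K `<=` A -> LIP_loc A f ->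
  exists g (M L : R), [/\ LIP_loc setT g, (0 < M)%R /\ (forall x, `|g x| <= M)%R,
    (0 <= L)%R /\ (forall x, lip_a g x <= L%:E) &
    forall x, K x -> g x = f x /\ lip_a g x <= lip_a f x].
Proof.
move=> oA cK KA hf.
have hnf : LIP_loc A (fun x => `|f x|%R).
  apply: (@LIP_loc_comp _ _ _ A f (@Num.norm _ _) 1%R ltr01 oA) hf => a b.
  by rewrite mul1r; exact: ler_dist_dist.
pose V (n : nat) := (A `&` [set x | (`|f x| < n%:R)%R]) `&` [set x | lip_a f x < n%:R%:E].
have [n KV] : exists n, K `<=` V n.
  apply: compact_increasing_cover => //.
  - move=> n; apply: openI; first exact: LIP_loc_open_lt.
    exact: open_lip_a_lt.
  - move=> i j ij x [[Ax /= fx] /= lx]; split; first split=> //=.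
      by rewrite (lt_le_trans fx)// ler_nat.
    by rewrite /= (lt_le_trans lx)// lee_fin ler_nat.
  - move=> x /KA Ax; have lE := lip_a_fineK (LIP_loc_lty hf Ax).
    exists (maxn (Num.bound `|f x|%R) (Num.bound (fine (lip_a f x)))).
    split; first split=> //=.
      by rewrite (lt_le_trans (archi_boundP _))// ler_nat leq_maxl.
    rewrite /= lE lte_fin (lt_le_trans (archi_boundP _))// ?ler_nat ?leq_maxr//.
    by rewrite fine_ge0// lip_a_ge0.
set W := V n in KV.
have oW : open W by apply: openI; [exact: LIP_loc_open_lt|exact: open_lip_a_lt].
have [k Kk] : exists k : nat, K `<=` [set x | (k.+1%:R^-1 < tdist (~` W) x)%R].
  apply: compact_increasing_cover => //.
  - by move=> k; exact: open_tdist_gt.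
  - move=> i j ij x /=; apply: le_lt_trans.
    by rewrite lef_pV2 ?posrE// ler_nat ltnS.
  - move=> x /KV Wx; have [r r0 rW] := open_ballP oW Wx.
    pose r' := Num.min r 1%R; have r'0 : (0 < r')%R by rewrite lt_min r0 ltr01.
    have r't : (r' <= tdist (~` W) x)%R.
      apply: tdist_ge; first by rewrite /r' ge_min lexx orbT.
      move=> y nWy; rewrite leNgt; apply/negP => xy; apply: nWy; apply: rW.
      by rewrite ballEmdist /= (lt_le_trans xy)// /r' ge_min lexx.
    have [N _ HN] := near_infty_natSinv_lt (PosNum r'0).
    by exists N => /=; apply: lt_le_trans r't; exact: HN (leqnn _).
(* Half of the distance, so that the ramp, which reaches 1 at [2 * s], equals 1 on a neighbourhood
   of [K]. *)
pose s : R := (k.+1%:R^-1 / 2)%R.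
have s0 : (0 < s)%R by rewrite divr_gt0// invr_gt0.
have s2 : (2 * s = k.+1%:R^-1)%R by rewrite mulrC divfK.
pose eta := ramp (~` W) s.
pose g := fun x => (eta x * f x)%R.
have n0 : (0 <= n%:R :> R)%R by [].
have in_W x : (s <= tdist (~` W) x)%R -> W x.
  by move=> sx; apply: contrapT => nWx; move: sx; rewrite tdist_eq0 //; lra.
have eta01 x := ramp_itv (~` W) s x.
have gM x : (`|g x| <= n%:R)%R.
  have [sx|/ltW sx] := leP s (tdist (~` W) x).
    have [[_ /= /ltW fx] _] := in_W x sx.
    have /andP[e0 e1] := eta01 x.
    by rewrite /g normrM ger0_norm// (le_trans _ fx)// ler_piMl.
  by rewrite /g /eta ramp0// mul0r normr0.
have gL x : lip_a g x <= (n%:R + n%:R / s)%:E.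
  have [sx|sx] := leP s (tdist (~` W) x).
    have [[Ax /= fx] /= lx] := in_W x sx.
    have ef := LIP_loc_lty (LIP_loc_ramp (~` W) s0) (x := x) I.
    apply: le_trans (lip_a_mul ef (LIP_loc_lty hf Ax)) _.
    have : lip_a (ramp (~` W) s) x <= (s^-1)%:E.
      by apply: lipschitz_lip_a => [|y z]; [rewrite invr_ge0 ltW|exact: ramp_lip].
    move: lx; rewrite (lip_a_fineK ef) (lip_a_fineK (LIP_loc_lty hf Ax)) !lte_fin !lee_fin.
    have l10 : (0 <= fine (lip_a f x))%R by rewrite fine_ge0// lip_a_ge0.
    have l20 : (0 <= fine (lip_a (ramp (~` W) s) x))%R by rewrite fine_ge0// lip_a_ge0.
    move=> lx le.
    have /andP[e0 e1] := eta01 x.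
    apply: lerD; last by apply: ler_pM => //; exact: ltW.
    rewrite ger0_norm// -[leRHS]mul1r; apply: ler_pM => //; exact: ltW.
  have [r r0 rs] := open_ballP (@open_tdist_lt _ _ _ (~` W) s) sx.
  rewrite (lip_a_cst0 (a := 0%R) r0) ?lee_fin ?addr_ge0 ?divr_ge0 ?(ltW s0)// => y /rs /= ys.
  by rewrite /g /eta ramp0 ?mul0r// ltW.
exists g, (n%:R + 1)%R, (n%:R + n%:R / s)%R; split.
- apply: LIP_locP => [|x _]; first exact: openT.
  exact: le_lt_trans (gL x) (ltry _).
- split; first by lra.
  by move=> x; have := gM x; lra.
- by split=> //; rewrite addr_ge0 ?divr_ge0// ltW.
- move=> x Kx; have xk := Kk x Kx.
  have gf y : (k.+1%:R^-1 < tdist (~` W) y)%R -> g y = f y.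
    by move=> yk; rewrite /g /eta ramp1 ?mul1r// s2 ltW.
  split; first exact: gf.
  have [r r0 rs] := open_ballP (@open_tdist_gt _ _ _ (~` W) k.+1%:R^-1%R) xk.
  by apply: (lip_a_near r0) => y /rs; exact: gf.
Qed.

(** Finitely many of the neighbourhoods of L^1 convergence cover [K]; the restricted measure turns
    integrals over [U x] into integrals over its trace on [K]. *)
Lemma cvg_L1loc_compact A K (mK : measurable K) (f_ : nat -> X -> R) f : open A -> compact K ->
  K `<=` A -> (forall n, LIP_loc A (f_ n)) -> measurable_fun setT f ->
  cvg_L1loc (mrestr m mK) A f_ f ->
  forall e, (0 < e)%R -> \forall n \near \oo, \int[m]_(x in K) `|f_ n x - f x|%:E <= e%:E.
Proof.
move=> oA cK KA hf mf Hc.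
have mA : measurable A by exact: open_measurable_borel.
have mF n (D : set X) : measurable D -> D `<=` A -> measurable_fun D (fun x => `|f_ n x - f x|%:E).
  move=> mD DA; apply: measurable_abs_sub; last exact: measurable_funTS.
  by apply: (measurable_funS mA DA); exact: measurable_LIP_loc.
have F0 n x : 0 <= `|f_ n x - f x|%:E by rewrite lee_fin.
have P x : exists U : set X, A x -> open_nbhs x U /\
    (fun n => \int[mrestr m mK]_(y in U `&` A) `|f_ n y - f y|%:E) @ \oo --> 0.
  have [Ax|nAx] := pselect (A x); last by exists setT.
  by have [U oU HU] := Hc x Ax; exists U.
have [U HU] := choice P.
have mU x : A x -> measurable (U x).
  by move=> /HU[[oU _] _]; exact: open_measurable_borel.
have HK x : K x -> forall e, (0 < e)%R ->
    \forall n \near \oo, \int[m]_(y in K `&` U x) `|f_ n y - f y|%:E <= e%:E.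
  move=> Kx e e0; have [_ H] := HU x (KA x Kx).
  have : \forall n \near \oo, \int[mrestr m mK]_(y in U x `&` A) `|f_ n y - f y|%:E < e%:E.
    move: H => /(_ [set y | y < e%:E]); apply.
    by apply: open_nbhs_nbhs; split; [exact: open_ereal_lt_ereal|rewrite /= lte_fin].
  apply: filterS => n /ltW; apply: le_trans.
  have mUA : measurable (U x `&` A) by apply: measurableI => //; apply: mU; exact: KA.
  rewrite integral_mrestr//; last by apply: mF => //; exact: subIsetr.
  rewrite (_ : U x `&` A `&` K = K `&` U x)//.
  by apply/seteqP; split=> y; [move=> [[? ?] ?]|move=> [? ?]; do 2?split=> //; exact: KA].
have [D DK KD] : finite_subset_cover K U K.
  move: cK; rewrite compact_cover; apply; first by move=> x /KA /HU[[]].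
  by move=> x Kx; exists x => //; have [[]] := HU x (KA x Kx).
(* Induction on the finite cover: each new neighbourhood is split off disjointly, which makes the
   integrals add. *)
have step (s : seq X) : {subset s <= K} -> measurable (K `&` [set y | exists2 i, i \in s & U i y]) /\
    forall e, (0 < e)%R -> \forall n \near \oo,
    \int[m]_(y in K `&` [set y | exists2 i, i \in s & U i y]) `|f_ n y - f y|%:E <= e%:E.
  elim: s => [|a s IH] sK.
    rewrite (_ : K `&` _ = set0); last by rewrite -subset0 => y [_ []].
    by split=> // e e0; apply: nearW => n; rewrite integral_set0 lee_fin ltW.
  have [mS HS] := IH (fun i si => sK i (mem_behead (s := a :: s) si)).
  have Ka : K a by have := sK a (mem_head _ _); rewrite inE.
  have mKa : measurable (K `&` U a) by apply: measurableI => //; apply: mU; exact: KA.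
  set S := K `&` [set y | exists2 i, i \in s & U i y] in mS HS.
  have -> : K `&` [set y | exists2 i, i \in a :: s & U i y] = (K `&` U a) `|` (S `\` (K `&` U a)).
    rewrite setUDr setDv setD0 /S; apply/seteqP; split=> y.
      move=> [Ky [i]]; rewrite inE => /orP[/eqP ->|si] Uy; [by left|right; split=> //; by exists i].
    by case=> [[Ky Uy]|[Ky [i si Uy]]]; split=> //;
      [exists a => //; rewrite mem_head|exists i => //; rewrite inE si orbT].
  have mSD : measurable (S `\` (K `&` U a)) by exact: measurableD.
  split; first exact: measurableU.
  move=> e e0; have e2 : (0 < e / 2)%R by rewrite divr_gt0.
  near=> n.
  rewrite ge0_integral_setU//; last 2 first.
  - by apply: mF; [exact: measurableU|move=> y [[]|[[]]] /KA].
  - by apply/disj_setPS => y [[? ?] [_]]; apply.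
  rewrite (splitr e) EFinD; apply: leeD; first by near: n; exact: HK.
  apply: (@le_trans _ _ (\int[m]_(y in S) `|f_ n y - f y|%:E)); last by near: n; exact: HS.
  apply: ge0_subset_integral => //.
  by apply: mF => // y [/KA].
have DK' : {subset (finmap.enum_fset D) <= K} by move=> i /DK; rewrite inE.
have [_ H] := step (finmap.enum_fset D) DK'.
move=> e e0; have := H e e0; rewrite (_ : K `&` _ = K)//.
apply/seteqP; split=> [y []//|y Ky]; split=> //.
by have [i /= iD Ui] := KD y Ky; exists i.
Unshelve. all: by end_near. Qed.

End localization.

(** * Energy bound for the zero extension *)

Section zero_extension_bound.
Context {d : measure_display} {R : realType} {X : completeMetricMeasurableType d R}.
Variable m : {measure set X -> \bar R}.
Hypothesis hX : metric_measure_space m.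
Variables (K : set X) (mK : measurable K) (c lam : R).
Hypotheses (lam0 : (0 < lam)%R) (cK : compact K) (Kfin : (m K < +oo)%E)
  (vK : variation_le m \1_K c)
  (Kmin : forall K' c', compact K' -> K' `<=` K -> variation_le m \1_K' c' ->
    (c <= c' + lam * fine (m (K `\` K')))%R).
Local Open Scope ereal_scope.

Let hB : borel_space X. Proof. by have [] := hX. Qed.

Lemma zero_extensionE (f : X -> R) : zero_extension K f = (fun x => f x * \1_K x)%R.
Proof.
apply/funext => x; rewrite /zero_extension /patch indicE.
by case: ifP; rewrite ?mulr1 ?mulr0.
Qed.

Lemma fine_le_real (x : \bar R) (r : R) : 0 <= x -> x <= r%:E -> (fine x <= r)%R.
Proof. by case: x => //= x _; rewrite lee_fin. Qed.

(** A nearly optimal approximant on a neighbourhood of [K] is replaced by a bounded global function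
    without raising its slope on [K]. The product estimate applies to that function, and lower
    semicontinuity passes to [f]. *)
Lemma zero_extension_variation_le (f : X -> R) (T I : R) : measurable_fun setT f ->
  \int[m]_(x in K) `|f x|%:E = I%:E ->
  Defs.total_variation (mrestr m mK) f K <= T%:E ->
  variation_le m (zero_extension K f) (2 * T + lam * I).
Proof.
move=> mf fI fT.
have m1K : measurable_fun setT (\1_K : X -> R) by exact: measurable_indic.
have mz : measurable_fun setT (zero_extension K f).
  by rewrite zero_extensionE; exact: measurable_funM.
apply: (variation_le_lsc hX) => // e e0.
have l4 : (0 < 4 + lam)%R by rewrite addr_gt0.
(* The slope integral exceeds [T] by at most [2 * e1] and enters with factor 2, the L^1 norm exceeds
   [I] by at most [e1] and enters with factor [lam]: the total error is [(4 + lam) * e1 = e]. *)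
pose e1 : R := (e / (4 + lam))%R.
have e10 : (0 < e1)%R by rewrite divr_gt0.
have e1e : ((4 + lam) * e1 = e)%R by rewrite mulrC divfK// gt_eqF.
have le10 : (0 <= lam * e1)%R by rewrite mulr_ge0// ltW.
rewrite mulrDl in e1e.
have : Defs.total_variation (mrestr m mK) f K < (T + e1)%:E.
  by apply: le_lt_trans fT _; rewrite lte_fin ltrDl.
move=> /ereal_inf_lt[_ [A [oA KA] <-]] /ereal_inf_lt[_ [f_ [hf cvf] <-]] /ltW lim_le.
have [N _ HN] := cvg_L1loc_compact hX oA cK KA hf mf cvf e10.
have [n Nn En] := limn_einf_frequently N lim_le e10.
have {HN} /= Fn := HN n Nn.
have mA : measurable A by exact: open_measurable_borel.
have mfA : measurable_fun A (f_ n : X -> R) by exact: measurable_LIP_loc.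
have mfK : measurable_fun K (f_ n : X -> R) by exact: measurable_funS mfA.
have [g [M [L [hg [M0 gM] [L0 gL] gf]]]] := LIP_loc_extend_compact oA cK KA (hf n).
have mg := measurable_LIP_locT hX hg.
exists (fun x => g x * \1_K x)%R, (2 * fine (\int[m]_(x in K) lip_a g x) +
  lam * fine (\int[m]_(x in K) `|g x|%:E))%R; split.
- exact: measurable_funM.
- rewrite zero_extensionE; apply: (@le_trans _ _ e1%:E); last by rewrite lee_fin; lra.
  apply: le_trans Fn; rewrite integral_mkcond le_eqVlt; apply/orP; left; apply/eqP.
  apply: eq_integral => x _; rewrite patchE indicE; case: ifPn => [xK|_].
    by rewrite !mulr1; have [-> _] := gf x (set_mem xK).
  by rewrite !mulr0 subrr normr0.
- have lipK : (fine (\int[m]_(x in K) lip_a g x) <= T + e1 + e1)%R.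
    apply: fine_le_real; first by apply: integral_ge0 => x _; exact: lip_a_ge0.
    apply: le_trans En; rewrite integral_mrestr//; last 2 first.
    + exact: measurable_lip_a.
    + by move=> x _; exact: lip_a_ge0.
    rewrite setIidr//; apply: ge0_le_integral => //; do ?exact: measurable_lip_a.
      by move=> x _; exact: lip_a_ge0.
    by move=> x Kx; have [] := gf x Kx.
  have absK : (fine (\int[m]_(x in K) `|g x|%:E) <= I + e1)%R.
    apply: fine_le_real; first by apply: integral_ge0 => x _; rewrite lee_fin.
    apply: (@le_trans _ _ (\int[m]_(x in K) (`|f x|%:E + `|f_ n x - f x|%:E))).
      have mfK' : measurable_fun K f by exact: measurable_funTS.
      apply: ge0_le_integral => //.
      + by apply/measurable_EFinP; apply: measurableT_comp => //; exact: measurable_funTS.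
      + apply: emeasurable_funD; last exact: measurable_abs_sub.
        by apply/measurable_EFinP; exact: measurableT_comp.
      + move=> x Kx; have [-> _] := gf x Kx; rewrite -EFinD lee_fin.
        by have := ler_normD (f x) (f_ n x - f x)%R; rewrite addrC subrK.
    have mfK' : measurable_fun K f by exact: measurable_funTS.
    rewrite ge0_integralD//; last 2 first.
    + by apply/measurable_EFinP; exact: measurableT_comp.
    + exact: measurable_abs_sub.
    by rewrite fI EFinD; exact: leeD.
  have := ler_wpM2l (ltW lam0) absK; rewrite mulrDr; lra.
- exact: (variation_le_mul_indic hX lam0 cK Kfin vK Kmin hg M0 L0 gM gL).
Qed.

End zero_extension_bound.

Theorem theorem3p4 (d : measure_display) (R : realType)
    (X : completeMetricMeasurableType d R) (m : {measure set X -> \bar R})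
    (hX : metric_measure_space m)
    (Omega : set X) (Omega_open : open Omega)
    (Omega_bounded : metric_bounded Omega) (eps : R) (eps_gt0 : 0 < eps) :
  exists (G : set X) (mG : measurable G),
    [/\ closed G, G `<=` Omega, (m (Omega `\` G) < eps%:E)%E &
      exists C : R, 0 < C /\
        forall f : X -> R, BV m mG f ->
          BV m measurableT (zero_extension G f) /\
          (BV_norm m measurableT (zero_extension G f)
             <= C%:E * BV_norm m mG f)%E].
Proof.
have hB : borel_space X by have [] := hX.
have e2 : 0 < eps / 2 by rewrite divr_gt0.
have [K0 [c0 [cK0 K0O mOK0 v0]]] := compact_approximation hX Omega_open Omega_bounded e2.
have mO : measurable Omega by exact: open_measurable_borel.
have Ofin : (m Omega < +oo)%E by have [_ _] := hX; apply.
have mK0 := compact_measurable hX cK0.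
have K0fin : (m K0 < +oo)%E.
  by apply: le_lt_trans Ofin; apply: le_measure; rewrite ?inE.
have c00 := variation_le_ge0 v0.
(* The descent gives [lam * m (K0 \ K) <= c0], so this choice makes the removed mass less than
   [eps / 4]; adding 1 keeps [lam] positive when [c0 = 0]. *)
pose lam : R := 4 * (c0 + 1) / eps.
have lam0 : 0 < lam by rewrite divr_gt0// mulr_gt0//; lra.
have [K [c [cK KK0 vK cle Kmin]]] := minimal_compact_subset hX lam0 cK0 K0fin v0.
have mK := compact_measurable hX cK.
have c_ge0 := variation_le_ge0 vK.
have Kfin : (m K < +oo)%E.
  by apply: le_lt_trans K0fin; apply: le_measure; rewrite ?inE.
exists K, mK; split.
- exact: compact_closed (@metric_hausdorff _ X) cK.
- exact: subset_trans KK0 K0O.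
- have mKfin : m (K0 `\` K) \is a fin_num.
    rewrite ge0_fin_numE//; apply: le_lt_trans K0fin.
    apply: le_measure; [rewrite inE; exact: measurableD|by rewrite inE|exact: subDsetl].
  have small : (m (K0 `\` K) <= (eps / 4)%:E)%E.
    rewrite -(fineK mKfin) lee_fin leNgt; apply/negP => H.
    have : lam * (eps / 4) = c0 + 1.
      by rewrite /lam mulrA divfK ?gt_eqF// mulrAC divff ?mul1r.
    have := ltr_pM2l lam0 (eps / 4) (fine (m (K0 `\` K))).
    by rewrite H => ?; lra.
  apply: (@le_lt_trans _ _ (m (Omega `\` K0) + m (K0 `\` K))%E).
    apply: (@le_trans _ _ (m ((Omega `\` K0) `|` (K0 `\` K)))).
      apply: le_measure; rewrite ?inE; do ?[exact: measurableD].
        by apply: measurableU; exact: measurableD.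
      by move=> x [Ox nKx]; have [?|?] := pselect (K0 x); [right|left].
    by apply: measureU2; exact: measurableD.
  apply: le_lt_trans (leeD mOK0 small) _.
  by rewrite -EFinD lte_fin; lra.
(* The norm of the extension is at most [I + 2 * T + lam * I], to be bounded by a multiple of
   [I + T]. *)
exists (3 + lam); split; first by lra.
move=> f [/integrableP[/measurable_EFinP mf If] TVf].
have mrT : (mrestr m measurableT : {measure set X -> \bar R}) = m.
  by apply: eq_measure; apply/funext => A; rewrite /= /mrestr setIT.
have mabs : measurable_fun setT (fun x => `|f x|%:E).
  by apply/measurable_EFinP; exact: measurableT_comp.
have IE : (\int[mrestr m mK]_x `|f x|%:E = \int[m]_(x in K) `|f x|%:E)%E.
  by rewrite integral_mrestr// setTI.
have I0 : (0 <= \int[m]_(x in K) `|f x|%:E)%E by apply: integral_ge0 => x _; rewrite lee_fin.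
have Ifin : (\int[m]_(x in K) `|f x|%:E)%E \is a fin_num.
  by rewrite ge0_fin_numE// -IE.
have T0 : (0 <= Defs.total_variation (mrestr m mK) f K)%E.
  apply: le_ereal_inf_tmp => _ [A [oA KA] <-].
  apply: le_ereal_inf_tmp => _ [f_ _ <-].
  by apply: (@limn_einf_ge _ _ _ 0) => n _; apply: integral_ge0 => x _; exact: lip_a_ge0.
have Tfin : Defs.total_variation (mrestr m mK) f K \is a fin_num by rewrite ge0_fin_numE.
set I := fine (\int[m]_(x in K) `|f x|%:E)%E.
set T := fine (Defs.total_variation (mrestr m mK) f K).
have fI : (\int[m]_(x in K) `|f x|%:E)%E = I%:E by rewrite fineK.
have fT : Defs.total_variation (mrestr m mK) f K = T%:E by rewrite fineK.
have Ige0 : 0 <= I by rewrite fine_ge0.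
have Tge0 : 0 <= T by rewrite fine_ge0.
have vz : variation_le m (zero_extension K f) (2 * T + lam * I).
  by apply: (zero_extension_variation_le hX (mK := mK) lam0 cK Kfin vK Kmin) => //; rewrite fT.
have TVz := variation_le_total_variation vz.
have mz : measurable_fun setT (zero_extension K f).
  by rewrite zero_extensionE; apply: measurable_funM => //; exact: measurable_indic.
have Iz : (\int[m]_x `|zero_extension K f x|%:E = I%:E)%E.
  rewrite -fI [RHS]integral_mkcond; apply: eq_integral => x _.
  by rewrite /zero_extension !patchE; case: ifP; rewrite ?normr0.
split.
  rewrite /BV mrT; split=> /=; last by apply: le_lt_trans TVz (ltry _).
  apply/integrableP; split; first exact/measurable_EFinP.
  rewrite (_ : (\int[_]_x _)%E = I%:E) ?ltry// -Iz.
  by apply: eq_measure_integral => A _ _; rewrite /= /mrestr setIT.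
apply: (@le_trans _ _ (I%:E + (2 * T + lam * I)%:E)%E).
  apply: leeD; last by rewrite mrT.
  rewrite le_eqVlt -Iz; apply/orP; left; apply/eqP.
  by apply: eq_measure_integral => A _ _; rewrite /= /mrestr setIT.
rewrite /BV_norm IE fI fT -!EFinD -EFinM lee_fin.
have := mulr_ge0 (ltW lam0) Tge0; rewrite mulrDl !mulrDr; lra.
Qed.
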